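(* Let $\mu>0$ and $\lambda>0$, and consider, for $n\in\mathbb N^+$, the Hamiltonian system $\dot{\mathbf Z}(t)=\mathcal J_{\mathbb R^{2n}}\nabla H_{\mathbb R^{2n}}(\mathbf Z(t))$ on $\mathbb D^n\setminus\Delta$ with Hamiltonian $$H_{\mathbb R^{2n}}(\mathbf Z)=-\frac12\Big(\mu\sum_{i=1}^n\log\frac1{1-|z_i|^2}+\lambda\sum_{1\le i<j\le n}\log|z_i-z_j|^2\Big).$$ Then for any $n\in\mathbb N^+$ this system has infinitely many non-trivial relative choreographies (as solutions).
   Context: Notation: $\mathbf Z=(z_1,\dots,z_n)$ with $z_i=(x_i,y_i)\in\mathbb R^2\equiv\mathbb C$. $\mathbb D=\{z\in\mathbb R^2:|z|<1\}$, $\Delta=\bigcup_{i<j}\{\mathbf Z: z_i=z_j\}$. $\mathcal J_{\mathbb R^{2n}}$ is the block-diagonal matrix with $n$ blocks $\begin{bmatrix}0&1\\-1&0\end{bmatrix}$. The system is invariant under the diagonal rotation action, and $I(\mathbf Z)=\sum_i|z_i|^2$ is conserved. Restricting to a level sphere of $I$ and quotienting by rotations, via $\mathbf Z\mapsto[z_1:\dots:z_n]$, gives a reduced Hamiltonian system on (an open subset of) $\mathbb{CP}^{n-1}$. Let $\sigma_1:\mathbb{CP}^{n-1}\to\mathbb{CP}^{n-1}$, $\sigma_1([z_1:\dots:z_n])=[z_n:z_1:\dots:z_{n-1}]$. A continuous $T$-periodic loop $\mathbf z$ in $\mathbb{CP}^{n-1}$ (normalised to $T=2\pi$ after rescaling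 time) is a reduced choreography if $\mathbf z(t+T/n)=\sigma_1\mathbf z(t)$ for all $t$; it is non-trivial if it is not constant in $\mathbb{CP}^{n-1}$. A curve $\mathbf Z(t)$ is a relative choreography if it is a lift of a reduced choreography $\mathbf z$ (i.e. it lies on a level sphere of $I$ and $[z_1(t):\dots:z_n(t)]=\mathbf z(t)$ for all $t$); it is non-trivial if $\mathbf z$ is non-trivial.
   Formalization: The theorem is stated for all n ≥ 2 instead of all n ≥ 1, because for n = 1 the space CP^0 is a single point, so every reduced choreography is constant and no non-trivial relative choreography exists. *)

(* Defs.v *)
From HB Require Import structures.
From mathcomp Require Import all_boot all_order all_algebra.
From mathcomp Require Import generic_quotient complex.
From mathcomp Require Import all_classical all_reals all_analysis.

Set Implicit Arguments.
Unset Strict Implicit.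
Unset Printing Implicit Defensive.

Import Order.TTheory GRing.Theory Num.Theory.
Import numFieldNormedType.Exports.

Local Open Scope classical_set_scope.
Local Open Scope quotient_scope.
Local Open Scope ring_scope.

(* A point of R^(2n) is an n x 2 real matrix whose i-th row is z_i = (x_i, y_i). *)
Notation config R n := 'M[R]_(n, 2).

Section Dynamics.
Variables (R : realType) (n : nat).
Implicit Types (Z : config R n) (z : 'rV[R]_2).

Definition sqnorm z : R := z 0 0 ^+ 2 + z 0 1 ^+ 2.

Definition hamiltonian (mu lambda : R) (Z : config R n) : R :=
  - (1 / 2) *
  (mu * (\sum_(i < n) ln (1 / (1 - sqnorm (row i Z)))) +
   lambda * (\sum_(i < n) \sum_(j < n | (i < j)%N)
               ln (sqnorm (row i Z - row j Z)))).

Definition gradient (f : config R n -> R) (Z : config R n) : config R n :=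
  \matrix_(i, k) 'D_(delta_mx i k) f Z.

(* [0 1; -1 0] *)
Definition J2 : 'M[R]_2 := delta_mx 0 1 - delta_mx 1 0.

(* The block-diagonal matrix with n blocks J2: it sends each z_i, here stored
   as a row vector, to J2 z_i. *)
Definition J2n Z : config R n := Z *m J2^T.

Definition polydisc : set (config R n) :=
  [set Z | forall i, sqnorm (row i Z) < 1].

Definition collisions : set (config R n) :=
  [set Z | exists i j : 'I_n, (i < j)%N /\ row i Z = row j Z].

Definition is_solution (mu lambda : R) (Z : R -> config R n) : Prop :=
  forall t, (polydisc `\` collisions) (Z t) /\
    is_derive t 1 Z (J2n (gradient (hamiltonian mu lambda) (Z t))).

Definition inertia Z : R := \sum_(i < n) sqnorm (row i Z).

(* (z_1, ..., z_n) |-> (z_n, z_1, ..., z_(n-1)) *)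
Definition shift Z : config R n := \matrix_(i, k) Z (ord_pred i) k.

End Dynamics.

Section ProjectiveSpace.
Variables (R : realType) (n : nat).

Definition to_complex (Z : config R n) : 'rV[R[i]]_n :=
  \row_i (Complex (Z i 0) (Z i 1)).

Definition nonzero : set (config R n) := [set Z | Z != 0].

Definition proj_rel (u v : nonzero) : bool :=
  `[< exists2 c : R[i], c != 0 &
        to_complex (\val v) = c *: to_complex (\val u) >].

Lemma proj_rel_refl : reflexive proj_rel.
Proof. by move=> u; apply/asboolP; exists 1; rewrite ?oner_neq0 ?scale1r. Qed.

Lemma proj_rel_sym : symmetric proj_rel.
Proof.
suff h u v : proj_rel u v -> proj_rel v u by move=> u v; apply/idP/idP; exact: h.
move=> /asboolP[c c0 e]; apply/asboolP; exists c^-1; first by rewrite invr_eq0.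
by rewrite e scalerA mulVf // scale1r.
Qed.

Lemma proj_rel_trans : transitive proj_rel.
Proof.
move=> v u w /asboolP[c c0 e] /asboolP[d d0 f]; apply/asboolP.
by exists (d * c); rewrite ?mulf_neq0 // f e scalerA.
Qed.

Canonical proj_equiv := EquivRel proj_rel proj_rel_refl proj_rel_sym proj_rel_trans.

(* CP^(n-1), given by n homogeneous coordinates. *)
Definition CP : Type := quotient_topology {eq_quot proj_equiv}.
HB.instance Definition _ := Topological.on CP.
HB.instance Definition _ := Quotient.on CP.

(* [z_1 : ... : z_n] *)
Definition homog (u : nonzero) : CP := \pi_CP u.

Lemma homogP u v : reflect (homog u = homog v) (proj_rel u v).
Proof. by apply: (iffP idP) => [h|/eqmodP //]; apply/eqmodP. Qed.

Lemma shift_nonzero (u : nonzero) : shift (\val u) \in nonzero.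
Proof.
apply/mem_set; case: u => Z /= /set_mem /= Z0; apply: contra Z0 => /eqP e.
apply/eqP/matrixP => i k; move/matrixP: e => /(_ (ordS i) k).
by rewrite !mxE ordSK.
Qed.

Definition shift_nz (u : nonzero) : nonzero := SigSub (shift_nonzero u).

Definition sigma1 (p : CP) : CP := homog (shift_nz (repr p)).

Lemma sigma1E (u : nonzero) : sigma1 (homog u) = homog (shift_nz u).
Proof.
apply/homogP/asboolP.
have /homogP/asboolP[c c0 e] : homog (repr (homog u)) = homog u by exact: reprK.
exists c => //; apply/rowP => i.
by move/rowP: e => /(_ (ord_pred i)); rewrite !mxE.
Qed.

Definition is_reduced_choreography (p : R -> CP) : Prop :=
  continuous p /\
  exists2 T : R, 0 < T &
    (forall t, p (t + T) = p t) /\ (forall t, p (t + T / n%:R) = sigma1 (p t)).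

Definition is_nontrivial (p : R -> CP) : Prop := ~ exists q, forall t, p t = q.

Definition is_lift (Z : R -> config R n) (p : R -> CP) : Prop :=
  (exists2 c : R, 0 < c & forall t, inertia (Z t) = c) /\
  (forall t, exists2 u : nonzero, \val u = Z t & homog u = p t).

(* Z is a non-trivial relative choreography, over the reduced choreography p. *)
Definition nontrivial_relative_choreography
    (Z : R -> config R n) (p : R -> CP) : Prop :=
  [/\ is_reduced_choreography p, is_nontrivial p & is_lift Z p].

(* The orbits in CP^(n-1) of the non-trivial relative choreographies that solve
   the system. Rotating or time-shifting a solution gives a continuum of further
   solutions with the same orbit, so counting orbits rather than curves Z keeps
   these trivial copies from making the count infinite. *)
Definition choreographic_orbits (mu lambda : R) : set (set CP) :=
  [set range p | p in [set p | exists2 Z, is_solution mu lambda Z &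
                                nontrivial_relative_choreography Z p]].

End ProjectiveSpace.

Arguments choreographic_orbits {R} n mu lambda.

(* Main.v *)
Require Import Defs.
From mathcomp Require Import all_boot all_order all_algebra.
From mathcomp Require Import generic_quotient complex.
From mathcomp Require Import all_classical all_reals all_analysis.
From mathcomp Require Import ring lra zify.

Set Implicit Arguments.
Unset Strict Implicit.
Unset Printing Implicit Defensive.

Import Order.TTheory GRing.Theory Num.Theory.
Import numFieldNormedType.Exports.

Local Open Scope classical_set_scope.
Local Open Scope ring_scope.

(** Place the [n] vortices on a circle of tiny radius [r] around a point of the
    disc other than its centre.  They turn about each other with an angular
    speed of order [lambda / r ^+ 2], while the confining term drags the whole
    cluster around the origin at a bounded speed.  In the frame that follows
    the cluster one sees, up to a relative error of order [r], a regular
    polygon spinning about a fixed point: after an [n]-th of a turn every vortex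
    has replaced the next one.  So, if this picture survives the error, it is a
    choreography modulo rotations, and it is not constant because the cluster
    really spins.

    To see that it survives, look for a single [2 pi]-periodic curve
    [q s = 1 / 2 + r e^(is) (1 + u s)] with
    [z_j t = e^(i Om t) q (w t - 2 pi j / n)].  All [n] equations then reduce to
    one equation for [q].  Fix [w = lambda a / r ^+ 2] with [a = (n - 1) / 2],
    the speed of the unconfined polygon, and write [b] for a multiple of the unknown
    [Om].  The equation becomes
    [a (u - i u') - lin u + b e^(-is) = quad u + O(r)], where [lin] and [quad]
    are the linear part and the remainder of the interaction.  The left side
    only couples the Fourier modes [k] and [- k], through a matrix of
    determinant [a ^+ 2 (1 - k ^+ 2) - beta_k ^+ 2].  This is negative for
    [|k| >= 2] whatever the real number [beta_k] is: no resonance can occur for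
    any [n].  The mode [1] decouples and is invertible; so is the mode [0], as
    long as the coefficients are real, which the mirror symmetry
    [u (- s) = conj (u s)] guarantees; the mode [-1], a translation of the ring, is balanced by [b].
    Hence the left side has a bounded inverse ([linear_solve]), the right side
    is a weak contraction for small [u] and [r] ([forcing_lip]), and successive
    corrections converge ([weakly_nonlinear_solution]).  Only trigonometric
    polynomials are ever corrected, each residual being approximated by one of
    them, and all errors are measured in the sup norm.

    This gives a choreography for every small [r] ([ring_curve_exists],
    [ring_choreography]).  The quotient of [|z_0 - z_1| ^+ 2] by the moment of
    inertia is a function on the projective space.  It is of order at most [r]
    along the orbit with parameter [r], but positive along every orbit, since
    vortices do not collide.  Therefore finitely many orbits cannot exhaust
    these, however they are chosen ([infinite_of_arbitrarily_small]). *)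

(** * The modulus and the unit circle *)

Section ComplexExp.
Variable R : realType.
Local Notation C := R[i].
Local Notation normc := (@Normc.normc R).
Local Notation Re := (@complex.Re R).
Local Notation Im := (@complex.Im R).
Implicit Types (z w : C) (s t : R).

Lemma normc_ge0 z : 0 <= normc z.
Proof. by case: z => x y; exact: sqrtr_ge0. Qed.

Lemma le_normcB z w : normc (z - w) <= normc z + normc w.
Proof. by rewrite -(normcN w); exact: le_normcD. Qed.

Lemma normc_distC z w : normc (z - w) = normc (w - z).
Proof. by rewrite -normcN opprB. Qed.

Lemma normc_conj z : normc (conjc z) = normc z.
Proof. by case: z => x y; rewrite /Normc.normc /= sqrrN. Qed.

Lemma normc_real (x : R) : normc x%:C%C = `|x|.
Proof. by rewrite /Normc.normc /= expr0n addr0 sqrtr_sqr. Qed.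

Lemma Re_add z w : Re (z + w) = Re z + Re w. Proof. by case: z w => ? ? []. Qed.
Lemma Im_add z w : Im (z + w) = Im z + Im w. Proof. by case: z w => ? ? []. Qed.

Lemma Re_mul z w : Re (z * w) = Re z * Re w - Im z * Im w.
Proof. by case: z w => ? ? []. Qed.

Lemma Im_mul z w : Im (z * w) = Re z * Im w + Im z * Re w.
Proof. by case: z w => ? ? []. Qed.

Lemma Re_scale (x : R) z : Re (x%:C%C * z) = x * Re z.
Proof. by rewrite Re_mul /= mul0r subr0. Qed.

Lemma Im_scale (x : R) z : Im (x%:C%C * z) = x * Im z.
Proof. by rewrite Im_mul /= mul0r addr0. Qed.

Lemma eq_ReIm z w : Re z = Re w -> Im z = Im w -> z = w.
Proof. by case: z w => ? ? [? ?] /= -> ->. Qed.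

Lemma conjcD z w : conjc (z + w) = conjc z + conjc w.
Proof. exact: rmorphD. Qed.

Lemma conjcB z w : conjc (z - w) = conjc z - conjc w.
Proof. exact: rmorphB. Qed.

Lemma conjcM z w : conjc (z * w) = conjc z * conjc w.
Proof. exact: rmorphM. Qed.

Lemma conjcR (x : R) : conjc x%:C%C = x%:C%C.
Proof. by rewrite /= oppr0. Qed.

Lemma conjc_sum (I : Type) (r : seq I) (P : pred I) (F : I -> C) :
  conjc (\sum_(i <- r | P i) F i) = \sum_(i <- r | P i) conjc (F i).
Proof. exact: rmorph_sum. Qed.

Lemma sqr_normcE z : normc z ^+ 2 = Re z ^+ 2 + Im z ^+ 2.
Proof. by case: z => x y; rewrite /Normc.normc sqr_sqrtr ?addr_ge0 ?sqr_ge0. Qed.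

Lemma mulc_conj z : z * conjc z = (normc z ^+ 2)%:C%C.
Proof.
rewrite sqr_normcE; case: z => x y; apply/eqP; rewrite eq_complex /=.
by apply/andP; split; apply/eqP; ring.
Qed.

Lemma normc_eq0 z : (normc z == 0) = (z == 0).
Proof.
apply/eqP/eqP => [/Normc.eq0_normc //|->]; exact: Normc.normc0.
Qed.

Lemma normc_gt0 z : (0 < normc z) = (z != 0).
Proof. by rewrite lt_neqAle normc_ge0 andbT eq_sym normc_eq0. Qed.

Lemma normc_Re z : `|Re z| <= normc z.
Proof.
rewrite -(@ler_pXn2r _ 2) ?nnegrE ?normc_ge0 // sqr_normcE real_normK ?num_real //.
by rewrite lerDl sqr_ge0.
Qed.

Lemma normc_Im z : `|Im z| <= normc z.
Proof.
rewrite -(@ler_pXn2r _ 2) ?nnegrE ?normc_ge0 // sqr_normcE real_normK ?num_real //.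
by rewrite lerDr sqr_ge0.
Qed.

Lemma normc_le z : normc z <= `|Re z| + `|Im z|.
Proof.
rewrite -(@ler_pXn2r _ 2) ?nnegrE ?normc_ge0 ?addr_ge0 // sqr_normcE.
rewrite -[Re z ^+ 2]real_normK ?num_real // -[Im z ^+ 2]real_normK ?num_real //.
have := normr_ge0 (Re z); have := normr_ge0 (Im z); nra.
Qed.

Lemma normcX z k : normc (z ^+ k) = normc z ^+ k.
Proof.
elim: k => [|k IH]; first by rewrite !expr0 Normc.normc1.
by rewrite !exprS Normc.normcM IH.
Qed.

Lemma normc_sum (I : Type) (r : seq I) (P : pred I) (F : I -> C) :
  normc (\sum_(i <- r | P i) F i) <= \sum_(i <- r | P i) normc (F i).
Proof.
apply: (big_ind2 (fun z x => normc z <= x)) => //; first by rewrite Normc.normc0.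
by move=> z x w y zx wy; apply: le_trans (le_normcD _ _) _; exact: lerD.
Qed.

Lemma Re_sum (I : Type) (r : seq I) (P : pred I) (F : I -> C) :
  Re (\sum_(i <- r | P i) F i) = \sum_(i <- r | P i) Re (F i).
Proof. by apply: (big_morph (@complex.Re R) Re_add). Qed.

Lemma Im_sum (I : Type) (r : seq I) (P : pred I) (F : I -> C) :
  Im (\sum_(i <- r | P i) F i) = \sum_(i <- r | P i) Im (F i).
Proof. by apply: (big_morph (@complex.Im R) Im_add). Qed.

Definition expi s : C := Complex (cos s) (sin s).

Lemma expi0 : expi 0 = 1.
Proof. by rewrite /expi cos0 sin0. Qed.

Lemma expiD s t : expi (s + t) = expi s * expi t.
Proof.
rewrite /expi cosD sinD; apply/eqP; rewrite eq_complex /=.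
by apply/andP; split; apply/eqP; ring.
Qed.

Lemma expiN s : expi (- s) = conjc (expi s).
Proof. by rewrite /expi cosN sinN. Qed.

Lemma normc_expi s : normc (expi s) = 1.
Proof. by rewrite /Normc.normc /expi cos2Dsin2 sqrtr1. Qed.

Lemma expi_neq0 s : expi s != 0.
Proof. by rewrite -normc_gt0 normc_expi. Qed.

Lemma expiMn s k : expi (s *+ k) = expi s ^+ k.
Proof.
elim: k => [|k IH]; first by rewrite mulr0n expi0 expr0.
by rewrite mulrS expiD IH exprS.
Qed.

Lemma expi2pi : expi (pi *+ 2) = 1.
Proof. by rewrite /expi cos2pi sin2pi. Qed.

Lemma expi2piz (k : int) : expi (k%:~R * (pi *+ 2)) = 1.
Proof.
have pos (j : nat) : expi (j%:R * (pi *+ 2)) = 1.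
  by rewrite mulr_natl expiMn expi2pi expr1n.
case: k => j; first exact: pos.
by rewrite NegzE mulrNz mulNr expiN -[_%:~R]/(j.+1%:R) pos conjc1.
Qed.

Lemma expi_eq1 s : 0 < s < pi *+ 2 -> expi s != 1.
Proof.
move=> /andP[s0 s2]; apply/eqP => /(congr1 (@complex.Re R)) /= c1.
have : 0 < sin (s / 2).
  by apply: sin_gt0_pi; apply/andP; split; [lra|move: s2; rewrite mulr2n; lra].
have := cos_mulr2n (s / 2).
have -> : s / 2 *+ 2 = s by rewrite mulr2n; lra.
rewrite c1 cos2sin2 mulr2n => h p.
have /eqP : sin (s / 2) ^+ 2 = 0 by move: h; lra.
by rewrite sqrf_eq0 gt_eqF.
Qed.

(** * Derivatives of complex curves *)

Definition cderiv (f f' : R -> C) := forall s,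
  is_derive s 1 (fun t => Re (f t)) (Re (f' s)) /\
  is_derive s 1 (fun t => Im (f t)) (Im (f' s)).

Lemma cderiv_eq (f f' g g' : R -> C) :
  cderiv f f' -> f =1 g -> f' =1 g' -> cderiv g g'.
Proof. by move=> d /funext <- /funext <-. Qed.

Lemma cderiv_cst z : cderiv (fun=> z) (fun=> 0).
Proof. by move=> s; split; exact: is_derive_cst. Qed.

Lemma cderivD f f' g g' : cderiv f f' -> cderiv g g' ->
  cderiv (fun s => f s + g s) (fun s => f' s + g' s).
Proof.
move=> df dg s; have [fr fi] := df s; have [gr gi] := dg s.
by split; rewrite ?Re_add ?Im_add;
  under eq_fun do rewrite ?Re_add ?Im_add; exact: is_deriveD.
Qed.

Lemma cderivM f f' g g' : cderiv f f' -> cderiv g g' ->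
  cderiv (fun s => f s * g s) (fun s => f' s * g s + f s * g' s).
Proof.
move=> df dg s; have [fr fi] := df s; have [gr gi] := dg s.
split.
- rewrite (_ : (fun t => _) =
    ((fun t => Re (f t)) * (fun t => Re (g t)) - (fun t => Im (f t)) * (fun t => Im (g t))));
    last by apply/funext => t; rewrite Re_mul.
  apply: is_derive_eq (@is_deriveB _ _ _ _ _ _ _ _ _ (@is_deriveM _ _ _ _ _ _ _ _ fr gr)
    (@is_deriveM _ _ _ _ _ _ _ _ fi gi)) _.
  rewrite Re_add !Re_mul /GRing.scale /=; ring.
- rewrite (_ : (fun t => _) =
    ((fun t => Re (f t)) * (fun t => Im (g t)) + (fun t => Im (f t)) * (fun t => Re (g t))));
    last by apply/funext => t; rewrite Im_mul.
  apply: is_derive_eq (@is_deriveD _ _ _ _ _ _ _ _ _ (@is_deriveM _ _ _ _ _ _ _ _ fr gi)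
    (@is_deriveM _ _ _ _ _ _ _ _ fi gr)) _.
  rewrite Im_add !Im_mul /GRing.scale /=; ring.
Qed.

Lemma cderivZ z f f' : cderiv f f' -> cderiv (fun s => z * f s) (fun s => z * f' s).
Proof.
move=> df; apply: cderiv_eq (cderivM (cderiv_cst z) df) _ _ => // s.
by rewrite mul0r add0r.
Qed.

Lemma cderiv_sum (I : Type) (r : seq I) (F F' : I -> R -> C) :
  (forall i, cderiv (F i) (F' i)) ->
  cderiv (fun s => \sum_(i <- r) F i s) (fun s => \sum_(i <- r) F' i s).
Proof.
move=> dF; elim: r => [|i r IH].
  by apply: cderiv_eq (cderiv_cst 0) _ _ => s; rewrite big_nil.
by apply: cderiv_eq (cderivD (dF i) IH) _ _ => s; rewrite big_cons.
Qed.

Lemma cderiv_affine f f' (x y : R) : cderiv f f' ->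
  cderiv (fun t => f (x * t + y)) (fun t => x%:C%C * f' (x * t + y)).
Proof.
move=> df s; have [fr fi] := df (x * s + y).
have daff : is_derive s (1 : R) (fun t : R => x * t + y) x.
  rewrite (_ : (fun t => _) = x *: (id : R -> R) + cst y); last by apply/funext.
  by apply: is_derive_eq; rewrite addr0 /GRing.scale /= mulr1.
split; rewrite ?Re_scale ?Im_scale mulrC.
- exact: (@is_derive1_comp _ (fun t => Re (f t)) (fun t => x * t + y)).
- exact: (@is_derive1_comp _ (fun t => Im (f t)) (fun t => x * t + y)).
Qed.

Lemma cderiv_expi : cderiv expi (fun s => 'i%C * expi s).
Proof.
by move=> s; split => /=; apply: is_derive_eq; ring.
Qed.

End ComplexExp.

(** * Trigonometric polynomials and their uniform limits *)

Section TrigPoly.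
Variable R : realType.
Local Notation C := R[i].
Local Notation normc := (@Normc.normc R).
Local Notation Re := (@complex.Re R).
Local Notation Im := (@complex.Im R).
Implicit Types (z w : C) (s t : R) (f g : R -> C).

Definition mode (k : int) s : C := expi (k%:~R * s).

Lemma modeD j k s : mode (j + k) s = mode j s * mode k s.
Proof. by rewrite /mode -expiD intrD mulrDl. Qed.

Lemma modeDr k s t : mode k (s + t) = mode k s * mode k t.
Proof. by rewrite /mode -expiD mulrDr. Qed.

Lemma mode_oppr k s : mode k (- s) = conjc (mode k s).
Proof. by rewrite /mode mulrN expiN. Qed.

Lemma modeN k s : mode (- k) s = conjc (mode k s).
Proof. by rewrite /mode mulrNz mulNr expiN. Qed.

Lemma mode0 s : mode 0 s = 1.
Proof. by rewrite /mode mul0r expi0. Qed.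

Lemma mode1 s : mode 1 s = expi s.
Proof. by rewrite /mode mul1r. Qed.

Lemma normc_mode k s : normc (mode k s) = 1.
Proof. exact: normc_expi. Qed.

Lemma cderiv_mode k :
  cderiv (mode k) (fun s => (k%:~R)%:C%C * 'i%C * mode k s).
Proof.
apply: cderiv_eq (cderiv_affine k%:~R 0 (@cderiv_expi R)) _ _ => s;
  by rewrite /mode addr0 // mulrA.
Qed.

(** Frequencies may be repeated in the list, which makes sums and products of
    such functions a matter of concatenating and pairing lists. *)
Definition trigpoly f := exists l : seq (int * C),
  forall s, f s = \sum_(x <- l) x.2 * mode x.1 s.

Lemma trigpoly_mode k : trigpoly (mode k).
Proof. by exists [:: (k, 1)] => s; rewrite big_seq1 mul1r. Qed.

Lemma trigpoly_expi : trigpoly (@expi R).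
Proof. by exists [:: (1, 1)] => s; rewrite big_seq1 mode1 mul1r. Qed.

Lemma trigpolyD f g : trigpoly f -> trigpoly g -> trigpoly (fun s => f s + g s).
Proof. by move=> [l fl] [k gk]; exists (l ++ k) => s; rewrite big_cat fl gk. Qed.

Lemma trigpolyM f g : trigpoly f -> trigpoly g -> trigpoly (fun s => f s * g s).
Proof.
move=> [l fl] [k gk].
exists [seq (x.1 + y.1, x.2 * y.2) | x <- l, y <- k] => s.
rewrite fl gk big_allpairs_dep mulr_suml; apply: eq_bigr => x _.
by rewrite mulr_sumr; apply: eq_bigr => y _; rewrite modeD /=; ring.
Qed.

Lemma trigpoly_cst z : trigpoly (fun=> z).
Proof. by exists [:: (0, z)] => s; rewrite big_seq1 mode0 mulr1. Qed.

Lemma trigpolyZ z f : trigpoly f -> trigpoly (fun s => z * f s).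
Proof. exact/trigpolyM/trigpoly_cst. Qed.

Lemma trigpoly_sum (I : Type) (r : seq I) (F : I -> R -> C) :
  (forall i, trigpoly (F i)) -> trigpoly (fun s => \sum_(i <- r) F i s).
Proof.
move=> F_tp; elim: r => [|i r IH].
  by under eq_fun do rewrite big_nil; exact: trigpoly_cst.
by under eq_fun do rewrite big_cons; exact: trigpolyD.
Qed.

Lemma trigpoly_conj f : trigpoly f -> trigpoly (fun s => conjc (f s)).
Proof.
move=> [l fl]; exists [seq (- x.1, conjc x.2) | x <- l] => s.
rewrite fl big_map conjc_sum; apply: eq_bigr => x _.
by rewrite conjcM modeN.
Qed.

Lemma trigpoly_shift f t : trigpoly f -> trigpoly (fun s => f (s + t)).
Proof.
move=> [l fl]; exists [seq (x.1, x.2 * mode x.1 t) | x <- l] => s.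
by rewrite fl big_map; apply: eq_bigr => x _ /=; rewrite modeDr; ring.
Qed.

Lemma trigpoly_bounded f : trigpoly f ->
  exists2 M, 0 <= M & forall s, normc (f s) <= M.
Proof.
move=> [l fl]; exists (\sum_(x <- l) normc x.2) => [|s].
  by apply: sumr_ge0 => x _; exact: normc_ge0.
rewrite fl; apply: le_trans (normc_sum _ _ _) _; apply: ler_sum => x _.
by rewrite Normc.normcM normc_mode mulr1.
Qed.

Definition approximable f := forall e : R, 0 < e ->
  exists2 g, trigpoly g & forall s, normc (f s - g s) <= e.

Lemma approx_trigpoly f : trigpoly f -> approximable f.
Proof. by move=> tf e e0; exists f => // s; rewrite subrr Normc.normc0 ltW. Qed.

Lemma approx_limit f :
  (forall e, 0 < e -> exists2 g, approximable g & forall s, normc (f s - g s) <= e) ->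
  approximable f.
Proof.
move=> H e e0; have e2 : 0 < e / 2 by lra.
have [g /(_ _ e2)[h th gh] fg] := H _ e2; exists h => // s.
have -> : f s - h s = (f s - g s) + (g s - h s) by ring.
by apply: le_trans (le_normcD _ _) _; have := gh s; have := fg s; lra.
Qed.

Lemma approx_cst z : approximable (fun=> z).
Proof. exact/approx_trigpoly/trigpoly_cst. Qed.

Lemma approxD f g : approximable f -> approximable g ->
  approximable (fun s => f s + g s).
Proof.
move=> af ag e e0; have e2 : 0 < e / 2 by lra.
have [f1 tf ff] := af _ e2; have [g1 tg gg] := ag _ e2.
exists (fun s => f1 s + g1 s) => [|s]; first exact: trigpolyD.
have -> : f s + g s - (f1 s + g1 s) = (f s - f1 s) + (g s - g1 s) by ring.
by apply: le_trans (le_normcD _ _) _; have := ff s; have := gg s; lra.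
Qed.

Lemma approx_bounded f : approximable f ->
  exists2 M, 0 <= M & forall s, normc (f s) <= M.
Proof.
move=> /(_ _ ltr01)[g /trigpoly_bounded[M M0 gM] fg].
exists (1 + M) => [|s]; first lra.
have -> : f s = (f s - g s) + g s by ring.
by apply: le_trans (le_normcD _ _) _; apply: lerD.
Qed.

Lemma approxM f g : approximable f -> approximable g ->
  approximable (fun s => f s * g s).
Proof.
move=> af ag; apply: approx_limit => e e0.
have [M M0 gM] := approx_bounded ag.
have [f1 tf ff] := af (e / 2 / (M + 1)) ltac:(rewrite divr_gt0 //; lra).
have [K K0 fK] := trigpoly_bounded tf.
have [g1 tg gg] := ag (e / 2 / (K + 1)) ltac:(rewrite divr_gt0 //; lra).
exists (fun s => f1 s * g1 s) => [|s]; first exact/approx_trigpoly/trigpolyM.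
have -> : f s * g s - f1 s * g1 s = (f s - f1 s) * g s + f1 s * (g s - g1 s) by ring.
apply: le_trans (le_normcD _ _) _; rewrite !Normc.normcM.
have h1 : normc (f s - f1 s) * normc (g s) <= e / 2 / (M + 1) * (M + 1).
  by apply: ler_pM; rewrite ?normc_ge0 //; have := gM s; lra.
have h2 : normc (g s - g1 s) * normc (f1 s) <= e / 2 / (K + 1) * (K + 1).
  by apply: ler_pM; rewrite ?normc_ge0 //; have := fK s; lra.
rewrite divfK in h1; last lra.
rewrite divfK in h2; last lra.
lra.
Qed.

Lemma approxZ z f : approximable f -> approximable (fun s => z * f s).
Proof. by apply: approxM; exact: approx_cst. Qed.

Lemma approx_sum (I : Type) (r : seq I) (P : pred I) (F : I -> R -> C) :
  (forall i, P i -> approximable (F i)) ->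
  approximable (fun s => \sum_(i <- r | P i) F i s).
Proof.
move=> aF; elim: r => [|i r IH].
  by under eq_fun do rewrite big_nil; exact: approx_cst.
case Pi: (P i); under eq_fun do rewrite big_cons Pi; last exact: IH.
by apply: approxD => //; exact: aF.
Qed.

Lemma approxX f k : approximable f -> approximable (fun s => f s ^+ k).
Proof.
move=> af; elim: k => [|k IH].
  by under eq_fun do rewrite expr0; exact: approx_cst.
by under eq_fun do rewrite exprS; exact: approxM.
Qed.

(** The partial sums of the geometric series converge uniformly. *)
Lemma approx_inv1B f (r : R) : approximable f -> r < 1 ->
  (forall s, normc (f s) <= r) -> approximable (fun s => (1 - f s)^-1).
Proof.
move=> af r1 fr.
have r0 : 0 <= r by exact: le_trans (normc_ge0 _) (fr 0).
apply: approx_limit => e e0.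
have [k rk] : exists k, r ^+ k <= e * (1 - r).
  have /cvgrPdist_le/(_ (e * (1 - r))) : r ^+ k @[k --> \oo] --> (0 : R).
    by apply: cvg_expr; rewrite ger0_norm.
  case=> [|k _ /(_ k (leqnn k))]; first by rewrite mulr_gt0 // subr_gt0.
  by rewrite sub0r normrN ger0_norm ?exprn_ge0 // => h; exists k.
exists (fun s => \sum_(j < k) f s ^+ j) => [|s].
  by apply: approx_sum => j _; exact: approxX.
have f1 : 1 - r <= normc (1 - f s).
  have := le_normcD (1 - f s) (f s); rewrite subrK Normc.normc1.
  by have := fr s; lra.
have n0 : 1 - f s != 0 by rewrite -normc_gt0; lra.
have -> : (1 - f s)^-1 - \sum_(j < k) f s ^+ j = f s ^+ k / (1 - f s).
  apply: (mulfI n0); rewrite mulrBr divff // mulrCA divff // mulr1.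
  by rewrite -[1 - f s]opprB mulNr -subrX1; ring.
rewrite Normc.normcM Normc.normcV normcX ler_pdivrMr; last lra.
apply: le_trans (_ : r ^+ k <= _).
  by rewrite lerXn2r ?nnegrE ?normc_ge0.
by apply: le_trans rk _; rewrite ler_pM2l.
Qed.

Lemma approx_inv f z (r : R) : approximable f -> z != 0 -> r < normc z ->
  (forall s, normc (f s) <= r) -> approximable (fun s => (z + f s)^-1).
Proof.
move=> af z0 rz fr.
have z1 : 0 < normc z by rewrite normc_gt0.
have -> : (fun s => (z + f s)^-1) = (fun s => z^-1 * (1 - (- z^-1 * f s))^-1).
  apply/funext => s; rewrite -invfM; congr (_ ^-1).
  by rewrite mulNr opprK mulrDr mulr1 mulrA divff // mul1r.
apply: approxZ; apply: (@approx_inv1B _ (r / normc z)) => [||s].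
- exact: approxZ.
- by rewrite ltr_pdivrMr // mul1r.
- rewrite Normc.normcM normcN Normc.normcV mulrC.
  by rewrite ler_pM2r ?invr_gt0.
Qed.

(** * Real coefficients *)

(** For a trigonometric polynomial this symmetry means that all Fourier
    coefficients are real. *)
Definition reversible f := forall s, f (- s) = conjc (f s).

(** Locked, lest rewriting with lemmas on lists unfold its first element. *)
Definition zrange (N : nat) : seq int :=
  locked [seq i%:Z - N%:Z | i <- iota 0 N.*2.+1].

Lemma mem_zrange N k : (k \in zrange N) = (`|k| <= N)%N.
Proof.
rewrite /zrange -lock; apply/mapP/idP => [[j +]|kN]; first by rewrite mem_iota => ? ->; lia.
by exists (absz (k + N%:Z)%R); rewrite ?mem_iota; lia.
Qed.

Lemma uniq_zrange N : uniq (zrange N).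
Proof. by rewrite /zrange -lock map_inj_uniq ?iota_uniq // => i j /eqP; lia. Qed.

Lemma sum_zrangeN (V : nmodType) N (F : int -> V) :
  \sum_(k <- zrange N) F (- k) = \sum_(k <- zrange N) F k.
Proof.
rewrite -(big_map -%R xpredT F); apply: perm_big; apply: uniq_perm.
- by rewrite map_inj_uniq ?uniq_zrange //; exact: oppr_inj.
- exact: uniq_zrange.
move=> k; rewrite mem_zrange; apply/mapP/idP => [[j]|kN].
  by rewrite mem_zrange => jN ->; lia.
by exists (- k); rewrite ?mem_zrange ?opprK //; lia.
Qed.

Lemma sum_zrangeS (V : nmodType) N (F : int -> V) :
  \sum_(k <- zrange N.+1) F k = F (- N.+1%:Z) + F N.+1%:Z + \sum_(k <- zrange N) F k.
Proof.
transitivity (\sum_(k <- - N.+1%:Z :: N.+1%:Z :: zrange N) F k); last first.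
  by rewrite !big_cons addrA.
apply: perm_big; apply: uniq_perm.
- exact: uniq_zrange.
- by rewrite /= uniq_zrange !inE !mem_zrange; lia.
by move=> k; rewrite !inE !mem_zrange; lia.
Qed.

Definition realpoly N (c : int -> R) s : C :=
  \sum_(k <- zrange N) (c k)%:C%C * mode k s.

Lemma trigpoly_realpoly N c : trigpoly (realpoly N c).
Proof. by apply: trigpoly_sum => k; exact/trigpolyZ/trigpoly_mode. Qed.

Lemma reversible_realpoly N c : reversible (realpoly N c).
Proof.
move=> s; rewrite /realpoly conjc_sum; apply: eq_bigr => k _.
by rewrite conjcM conjcR mode_oppr.
Qed.

(** Averaging with the mirror image replaces each coefficient by its real
    part. *)
Lemma trigpoly_mean f : trigpoly f ->
  exists N c, forall s, (f s + conjc (f (- s))) / 2 = realpoly N c s.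
Proof.
move=> [l fl]; pose N := (\sum_(x <- l) `|x.1|)%N.
exists N; exists (fun k => \sum_(x <- l | x.1 == k) Re x.2) => s.
have lN x : x \in l -> x.1 \in zrange N.
  by move=> xl; rewrite mem_zrange /N (big_rem _ xl) leq_addr.
rewrite /realpoly.
under eq_bigr do rewrite raddf_sum /= mulr_suml.
rewrite (exchange_big_dep xpredT) //= !fl conjc_sum -big_split /= mulr_suml big_seq [RHS]big_seq.
apply: eq_bigr => x xl.
rewrite big_mkcond (bigD1_seq x.1) ?uniq_zrange ?lN //= eqxx big1 ?addr0; last first.
  by move=> k; rewrite eq_sym => /negbTE ->.
rewrite conjcM -mode_oppr opprK -mulrDl mulrAC; congr (_ * _).
by apply: (mulIf (_ : 2 != 0)); rewrite ?pnatr_eq0 // divfK ?pnatr_eq0 // addcJ mulrC.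
Qed.

Lemma approx_reversible f e : approximable f -> reversible f -> 0 < e ->
  exists N c, forall s, normc (f s - realpoly N c s) <= e.
Proof.
move=> af rf e0; have [g tg fg] := af _ e0.
have [N [c gE]] := trigpoly_mean tg; exists N, c => s.
have -> : f s - realpoly N c s = ((f s - g s) + conjc (f (- s) - g (- s))) * (2^-1)%:C%C.
  rewrite -gE conjcB rf conjcK fmorphV rmorph_nat.
  by field.
rewrite Normc.normcM normc_real ger0_norm ?invr_ge0 // ler_pdivrMr //.
apply: le_trans (le_normcD _ _) _; rewrite normc_conj.
by have := fg s; have := fg (- s); lra.
Qed.

(** Sampling at the [N.*2.+1]-th roots of unity turns Parseval's identity into
    the orthogonality of finitely many characters, so no integral is needed. *)
Lemma realpoly_bessel N c (M : R) : (forall s, normc (realpoly N c s) <= M) ->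
  \sum_(k <- zrange N) c k ^+ 2 <= M ^+ 2.
Proof.
move=> pM; pose K := N.*2.+1.
pose x (j : 'I_K) : R := j%:R * (pi *+ 2) / K%:R.
have K0 : K%:R != 0 :> R by rewrite pnatr_eq0.
(* The value at the sample points is a root of unity other than [1]. *)
have ortho (k : int) : (`|k| < K)%N -> k != 0 -> \sum_(j < K) mode k (x j) = 0.
  move=> kK k0; pose z : C := expi (k%:~R * (pi *+ 2) / K%:R).
  have zE j : mode k (x j) = z ^+ j.
    by rewrite /mode /x /z -expiMn -mulr_natr; congr expi; field.
  under eq_bigr do rewrite zE.
  have z1 : z != 1.
    wlog k_gt0 : k kK k0 @z {zE} / 0 < k => [H|].
      have [|] := ltP 0 k => [|k_le]; first exact: H.
      have := H (- k); rewrite oppr_gt0 lt_neqAle k0 k_le => /(_ _ _ isT).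
      rewrite /z mulrNz !mulNr expiN => h; apply/eqP => z1.
      have /eqP : conjc z != 1 by apply: h; lia.
      by rewrite /z z1 conjc1.
    apply: expi_eq1; have p0 := pi_gt0 R.
    have p2 : 0 < pi *+ 2 :> R by rewrite pmulrn_rgt0.
    rewrite divr_gt0 ?mulr_gt0 ?ltr0z ?ltr0n //= ltr_pdivrMr ?ltr0n // mulrC.
    by rewrite ltr_pM2l // -[K%:R]/(K%:~R) ltr_int; lia.
  apply: (mulfI (_ : z - 1 != 0)); first by rewrite subr_eq0.
  rewrite -subrX1 mulr0 /z -expiMn.
  have -> : k%:~R * (pi *+ 2) / K%:R *+ K = k%:~R * (pi *+ 2) :> R.
    by rewrite -[LHS]mulr_natr divfK.
  by rewrite expi2piz subrr.
have key : \sum_(j < K) (normc (realpoly N c (x j)) ^+ 2) =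
           K%:R * \sum_(k <- zrange N) c k ^+ 2.
  apply: (@complexI R); rewrite rmorphM /= !raddf_sum /=.
  under eq_bigr => j _.
    rewrite -mulc_conj {2}/realpoly conjc_sum {1}/realpoly mulr_suml.
    under eq_bigr => k _.
      rewrite mulr_sumr.
      under eq_bigr => i _.
        rewrite conjcM conjcR -modeN mulrACA -modeD.
        over.
      over.
    over.
  rewrite exchange_big mulr_sumr big_seq [RHS]big_seq; apply: eq_bigr => k kN /=.
  rewrite exchange_big (bigD1_seq k) ?uniq_zrange //= [X in _ + X]big_seq_cond [X in _ + X]big1 ?addr0.
    under eq_bigr do rewrite subrr mode0 mulr1.
    have -> : (K%:R : R)%:C%C = K%:R :> C by exact: rmorph_nat.
    by rewrite sumr_const card_ord mulr_natl expr2 rmorphM.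
  move=> i /andP[iN ik]; rewrite -mulr_sumr ortho ?mulr0 //.
    by move: kN iN; rewrite !mem_zrange /K; lia.
  by rewrite subr_eq0 eq_sym.
have M0 : 0 <= M by exact: le_trans (normc_ge0 _) (pM 0).
rewrite -(@ler_pM2l _ K%:R) ?ltr0n // -key.
apply: le_trans (_ : \sum_(j < K) M ^+ 2 <= _).
  by apply: ler_sum => j _; rewrite lerXn2r ?nnegrE ?normc_ge0.
by rewrite sumr_const card_ord mulr_natl.
Qed.

End TrigPoly.

(** * The linear problem *)

Section LinearProblem.
Variable R : realType.
Local Notation C := R[i].
Local Notation normc := (@Normc.normc R).
Local Notation Re := (@complex.Re R).
Local Notation Im := (@complex.Im R).

(** The two terms added at each step are below twice
    [1 / (N + 1) - 1 / (N + 2)], which telescopes. *)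
Lemma sum_invr_sqr N :
  \sum_(k <- zrange N) ((`|k|%N%:R + 1 : R) ^+ 2)^-1 <= 4 - 2 / N.+1%:R.
Proof.
elim: N => [|N IH].
  by rewrite /zrange -lock /= big_seq1 subrr /= add0r expr1n invr1; lra.
rewrite sum_zrangeS abszN /=.
have x0 : 0 < N.+1%:R :> R by rewrite ltr0n.
move: IH x0; rewrite -[N.+2%:R]natr1; set x : R := N.+1%:R => IH x0.
have p0 : 0 < x^-1 by rewrite invr_gt0.
have q0 : 0 < (x + 1)^-1 by rewrite invr_gt0; lra.
have px : x * x^-1 = 1 by rewrite mulfV //; lra.
have qx : (x + 1) * (x + 1)^-1 = 1 by rewrite mulfV //; lra.
rewrite -!exprVn.
move: p0 q0 px qx IH; set p := x^-1; set q := (x + 1)^-1 => p0 q0 px qx IH.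
have pq : p - q = p * q.
  have : p * ((x + 1) * q) - q * (x * p) = p * q by ring.
  by rewrite px qx !mulr1.
have : q <= p by nra.
have := mulr_ge0 (ltW q0) (ltW q0); nra.
Qed.

Variables (a B : R) (beta : int -> R).
Hypotheses (a_gt0 : 0 < a) (betaN : forall k, beta (- k) = beta k).
Hypotheses (beta1 : beta 1 = 0) (beta0 : beta 0 = - a).
Hypothesis beta_le : forall k, `|beta k| <= B.

Let det (k : int) : R := a ^+ 2 * (1 - k%:~R ^+ 2) - beta k ^+ 2.

(** The matrix entries of the inverse.  The determinant vanishes for [k] equal
    to [0], [1] and [-1]; there, on real coefficients, the equations are scalar,
    and the one for [-1] has coefficient [0]: the datum of that mode is not
    matched by [u]. *)
Let diag (k : int) : R :=
  if k == 0 then (2 * a)^-1 else if k == 1 then (2 * a)^-1 else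
  if k == -1 then 0 else a * (1 - k%:~R) / det k.

Let anti (k : int) : R := if (`|k| <= 1)%N then 0 else beta k / det k.

Let A : R := (3 * a + B) / a ^+ 2.

Let B_ge0 : 0 <= B.
Proof. exact: le_trans (normr_ge0 _) (beta_le 0). Qed.

Let A_E : A * a ^+ 2 = 3 * a + B.
Proof. by rewrite divfK // expf_neq0 // gt_eqF. Qed.

Let A_ge0 : 0 <= A.
Proof.
have a0 := ltW a_gt0.
by rewrite divr_ge0 ?exprn_ge0 ?addr_ge0 ?mulr_ge0.
Qed.

Let det_le (k : int) (x : R) : (1 < `|k|)%N -> x = `|k|%N%:R ->
  2 <= x /\ det k <= - (a ^+ 2 * (x ^+ 2 - 1)).
Proof.
move=> k1 ->; split; first by rewrite ler_nat.
rewrite /det -[k%:~R ^+ 2]real_normK ?num_real // -intr_norm -abszE.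
have := sqr_ge0 (beta k); rewrite -[_%:~R]/(`|k|%N%:R); nra.
Qed.

Let det_neq0 k : (1 < `|k|)%N -> det k != 0.
Proof.
move=> k1; have [x2 d] := det_le k1 erefl.
apply: ltr0_neq0; apply: le_lt_trans d _; rewrite oppr_lt0 mulr_gt0 ?exprn_gt0 //.
by rewrite subr_gt0 exprn_egt1 //; lra.
Qed.

Let diag_le k : `|diag k| * (`|k|%N%:R + 1) <= A.
Proof.
have half : (2 * a)^-1 * (1 + 1) <= A.
  rewrite mulrC ler_pdivrMr ?mulr_gt0 // -(@ler_pM2l _ a) //.
  have -> : a * (A * (2 * a)) = 2 * (A * a ^+ 2) by ring.
  rewrite A_E; have := B_ge0; have := a_gt0; lra.
have h0 : 0 < (2 * a)^-1 by rewrite invr_gt0 mulr_gt0.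
rewrite /diag; case: eqP => [->|/eqP k0].
  by rewrite /= add0r (ger0_norm (ltW h0)); lra.
case: eqP => [->|/eqP k1]; first by rewrite /= (ger0_norm (ltW h0)).
case: eqP => [->|/eqP k2]; first by rewrite normr0 mul0r.
have kk : (1 < `|k|)%N by lia.
have [x2 d] := det_le kk erefl.
rewrite normrM normfV mulrAC ler_pdivrMr ?normr_gt0 ?det_neq0 //.
have d0 : det k <= 0.
  by apply: le_trans d _; rewrite oppr_le0 mulr_ge0 ?sqr_ge0 // subr_ge0 exprn_ege1 //; lra.
rewrite (ler0_norm d0).
apply: le_trans (_ : A * (a ^+ 2 * ((`|k|%N%:R) ^+ 2 - 1)) <= _); last first.
  by rewrite ler_wpM2l ?A_ge0 // lerNr.
rewrite mulrA A_E normrM (ger0_norm (ltW a_gt0)).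
have h1 : `|1 - k%:~R| <= `|k|%N%:R + 1 :> R.
  apply: le_trans (ler_normB _ _) _; rewrite normr1 addrC -intr_norm -abszE.
  by rewrite -[_%:~R]/(`|k|%N%:R).
move: x2 h1; set x : R := `|k|%N%:R; set y := `|_| => x2 h1.
have h2 : a * y * (x + 1) <= a * (x + 1) * (x + 1).
  by apply: ler_wpM2r; [lra|rewrite ler_pM2l].
have h3 : 0 <= a * ((x + 1) * (x - 2)).
  by rewrite !mulr_ge0 ?(ltW a_gt0) //; lra.
have h4 : 0 <= B * ((x + 1) * (x - 1)).
  by rewrite !mulr_ge0 //; lra.
lra.
Qed.

Let anti_le k : `|anti k| * (`|k|%N%:R + 1) <= A.
Proof.
rewrite /anti; case: leqP => [_|kk]; first by rewrite normr0 mul0r.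
have [x2 d] := det_le kk erefl.
rewrite normrM normfV mulrAC ler_pdivrMr ?normr_gt0 ?det_neq0 //.
have d0 : det k <= 0.
  by apply: le_trans d _; rewrite oppr_le0 mulr_ge0 ?sqr_ge0 // subr_ge0 exprn_ege1 //; lra.
rewrite (ler0_norm d0).
apply: le_trans (_ : A * (a ^+ 2 * ((`|k|%N%:R) ^+ 2 - 1)) <= _); last first.
  by rewrite ler_wpM2l ?A_ge0 // lerNr.
rewrite mulrA A_E; have := beta_le k; have := normr_ge0 (beta k).
move: x2; set x : R := `|k|%N%:R; set y := `|_| => x2 y0 yB.
have h2 : y * (x + 1) <= B * (x + 1) by apply: ler_wpM2r => //; lra.
have h3 : 0 <= a * ((x + 1) * (x - 1)).
  by rewrite !mulr_ge0 ?(ltW a_gt0) //; lra.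
have h4 : 0 <= B * ((x + 1) * (x - 2)).
  by rewrite !mulr_ge0 //; lra.
lra.
Qed.

(** The modes [k] and [- k] are coupled by the matrix with diagonal
    [a (1 + k), a (1 - k)] and both off-diagonal entries [- beta k].  Its
    determinant is at most [- a ^+ 2 (k ^+ 2 - 1)], so there is no resonance for
    [|k| >= 2] whatever the value of [beta k], and inverting gains a factor of
    order [1 / |k|]. *)
Let sol (c : int -> R) k := diag k * c k + anti k * c (- k).

Let sol_eq c k : a * (1 + k%:~R) * sol c k - beta k * sol c (- k) =
  if k == -1 then 0 else c k.
Proof.
have a2 : a != 0 by rewrite gt_eqF.
rewrite /sol /diag /anti abszN.
have [kk|kk] := leqP `|k| 1; last first.
  have -> : (k == -1) = false by lia.
  have -> : (k == 0) = false by lia. have -> : (k == 1) = false by lia.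
  have -> : (- k == 0) = false by lia. have -> : (- k == 1) = false by lia.
  have -> : (- k == -1) = false by lia.
  have D0 := det_neq0 kk.
  have -> : det (- k) = det k by rewrite /det betaN mulrNz sqrrN.
  rewrite opprK betaN mulrNz.
  have DE : a ^+ 2 * (1 - k%:~R ^+ 2) - beta k ^+ 2 = det k by [].
  move: D0 DE; set D := det k => D0 DE.
  transitivity ((a ^+ 2 * (1 - k%:~R ^+ 2) - beta k ^+ 2) * D^-1 * c k); first by ring.
  by rewrite DE divff // mul1r.
have [->|k0] := eqVneq k 0.
  by rewrite oppr0 /= beta0 mul0r !addr0 mulr1; field.
have [->|k1] := eqVneq k 1.
  by rewrite /= beta1 !mul0r; field.
have -> : k = -1 by lia.
by rewrite /= betaN beta1; ring.
Qed.

Let sol_le c k : `|sol c k| <= A / (`|k|%N%:R + 1) * (`|c k| + `|c (- k)|).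
Proof.
have k0 : 0 < `|k|%N%:R + 1 :> R by rewrite ltr_wpDl // ler0n.
apply: le_trans (ler_normD _ _) _; rewrite !normrM mulrDr.
by apply: lerD; apply: ler_wpM2r => //; rewrite ler_pdivlMr ?diag_le ?anti_le.
Qed.

(** The unknown [b] takes the mode [-1] that [u] cannot reach.  The sup norm of
    [u] is controlled by the product of the square-summable coefficients of the
    datum with the factors [1 / (|k| + 1)] gained by the inversion. *)
Lemma linear_solve : exists2 K : R, 0 < K & forall N c (M : R), 0 < M ->
  (forall s, normc (realpoly N c s) <= M) ->
  exists (u : int -> R) (b : R), [/\
    forall s, \sum_(k <- zrange N)
       (a * (1 + k%:~R) * u k - beta k * u (- k))%:C%C * mode k s
       + b%:C%C * mode (- 1) s = realpoly N c s,
    forall s, normc (realpoly N u s) <= K * M &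
    `|b| <= K * M].
Proof.
exists (A * 5 + 1) => [|N c M M0 cM]; first by have := A_ge0; lra.
have bessel := realpoly_bessel cM.
exists (sol c), (if (0 < N)%N then c (-1) else 0); split=> [s|s|].
- under eq_bigr do rewrite sol_eq.
  case: ifP => N0.
    rewrite /realpoly (bigD1_seq (-1)) ?uniq_zrange ?mem_zrange //= mul0r add0r.
    rewrite [RHS](bigD1_seq (-1)) ?uniq_zrange ?mem_zrange //= addrC; congr (_ + _).
    by apply: eq_bigr => k /negbTE ->.
  rewrite mul0r addr0 /realpoly big_seq [RHS]big_seq; apply: eq_bigr => k.
  by rewrite mem_zrange => kN; case: eqP => // k1; lia.
- apply: le_trans (normc_sum _ _ _) _.
  under eq_bigr do rewrite Normc.normcM normc_mode mulr1 normc_real.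
  apply: le_trans (ler_sum _ _) _.
    by move=> k _; exact: sol_le.
  have -> : \sum_(k <- zrange N) A / (`|k|%N%:R + 1) * (`|c k| + `|c (- k)|) =
    A * (\sum_(k <- zrange N) (`|k|%N%:R + 1)^-1 * `|c k| *+ 2).
    under eq_bigr do rewrite mulrDr.
    rewrite big_split /= -[X in _ + X]sum_zrangeN -big_split /= mulr_sumr.
    apply: eq_bigr => k _; rewrite opprK abszN mulr2n; ring.
  apply: le_trans (_ : A * (M * 5) <= _); last first.
    by rewrite mulrDl; have := M0; lra.
  apply: ler_wpM2l => //.
  (* [2 x y <= y ^+ 2 / M + M x ^+ 2], weighted so that both sums are of order
     [M]. *)
  apply: le_trans (_ : \sum_(k <- zrange N) (M^-1 * c k ^+ 2 + M * ((`|k|%N%:R + 1) ^+ 2)^-1) <= _).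
    apply: ler_sum => k _; rewrite -exprVn -[c k ^+ 2]real_normK ?num_real //.
    set x := _^-1; set y := `|_|.
    have Mi : 0 < M^-1 by rewrite invr_gt0.
    have := sqr_ge0 (y - M * x) => h.
    have -> : M^-1 * y ^+ 2 + M * x ^+ 2 = M^-1 * (y - M * x) ^+ 2 + x * y *+ 2.
      by field; rewrite gt_eqF.
    by rewrite lerDr mulr_ge0 // ltW.
  rewrite big_split /= -!mulr_sumr.
  have : M^-1 * \sum_(k <- zrange N) c k ^+ 2 <= M.
    by rewrite ler_pdivrMl // -expr2.
  have : M * \sum_(k <- zrange N) ((`|k|%N%:R + 1) ^+ 2)^-1 <= M * 4.
    rewrite ler_pM2l //; apply: le_trans (sum_invr_sqr N) _.
    by rewrite gerBl divr_ge0.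
  lra.
- case: ifP => N0; last first.
    by have := A_ge0; have := ltW M0; rewrite normr0 => ? ?; apply: mulr_ge0 => //; lra.
  apply: le_trans (_ : M <= _); last first.
    have := A_ge0; have := ltW M0 => ? ?.
    by rewrite mulrDl mul1r lerDr -mulrA; apply: mulr_ge0 => //; lra.
  rewrite -(@ler_pXn2r _ 2) ?nnegrE ?normr_ge0 ?(ltW M0) // real_normK ?num_real //.
  apply: le_trans bessel.
  rewrite (bigD1_seq (-1)) ?uniq_zrange ?mem_zrange //= lerDl.
  by apply: sumr_ge0 => k _; exact: sqr_ge0.
Qed.

End LinearProblem.

(** * Limits of differentiable curves *)

Section Limits.
Variable R : realType.
Local Notation C := R[i].
Local Notation normc := (@Normc.normc R).
Local Notation Re := (@complex.Re R).
Local Notation Im := (@complex.Im R).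

Lemma bounded_derivative_lipschitz (f g : R -> R) (M : R) :
  (forall s : R, is_derive s (1 : R) f (g s)) -> (forall s, `|g s| <= M) ->
  forall x y, `|f y - f x| <= M * `|y - x|.
Proof.
move=> df gM x y.
wlog xy : x y / x <= y => [H|].
  have [/H //|/ltW/H] := leP x y.
  by rewrite distrC [`|x - y|]distrC.
have [|c _ ->] := MVT_segment xy (fun s _ => df s).
  apply/continuous_subspaceT => r; apply/differentiable_continuous/derivable1_diffP.
  by have [] := df r.
by rewrite normrM ler_wpM2r.
Qed.

(** By the mean value theorem the difference quotients of [F1 - F] are small
    whenever the derivatives of [F1] and [F] are both close to [g]; letting [F1]
    tend to [f] compares the difference quotients of [f] and [F]. *)
Lemma is_derive_unif (f g : R -> R) :
  (forall e, 0 < e -> exists F G : R -> R, (forall s : R, is_derive s (1 : R) F (G s)) /\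
    forall s, `|F s - f s| <= e /\ `|G s - g s| <= e) ->
  forall s : R, is_derive s (1 : R) f (g s).
Proof.
move=> H s.
suff cv : (fun h => h^-1 *: (f (h *: (1 : R) + s) - f s)) @ 0^' --> g s.
  by split; [exact: cvgP cv|exact/cvg_lim].
apply/cvgrPdist_le => e e0.
have e4 : 0 < e / 4 by lra.
have [F [G [dF FG]]] := H _ e4.
have [dFs FGs] := dF s.
have : (fun h => h^-1 *: (F (h *: (1 : R) + s) - F s)) @ 0^' --> G s.
  by rewrite -FGs; exact: dFs.
move=> /cvgrPdist_le/(_ _ e4); apply: filterS2 (nbhs_dnbhs_neq _) => h h0 hF.
have h_gt0 : 0 < `|h| by rewrite normr_gt0.
have key : `|(f (h *: (1 : R) + s) - f s) - (F (h *: (1 : R) + s) - F s)| <= `|h| * (e / 2).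
  (* Small enough for [d * `|h|] and the two errors [d] at the ends to add up
     to at most [`|h| * (e / 4)]. *)
  pose d := `|h| * (e / 4) / (`|h| + 2).
  have d0 : 0 < d by rewrite divr_gt0 ?mulr_gt0 //; lra.
  have dE : d * (`|h| + 2) = `|h| * (e / 4) by rewrite divfK //; lra.
  have [F1 [G1 [dF1 FG1]]] := H _ d0.
  have dFF t : is_derive t (1 : R) (fun t => F1 t - F t) (G1 t - G t) by exact: is_deriveB.
  have GG t : `|G1 t - G t| <= d + e / 4.
    have -> : G1 t - G t = (G1 t - g t) - (G t - g t) by ring.
    apply: le_trans (ler_normB _ _) _.
    by have := (FG1 t).2; have := (FG t).2; lra.
  have := bounded_derivative_lipschitz dFF GG s (h *: (1 : R) + s).
  rewrite addrK /GRing.scale /= mulr1.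
  have := (FG1 (h + s)).1; have := (FG1 s).1.
  move: (F1 (h + s)) (F (h + s)) (f (h + s)) (F1 s) (F s) (f s) => x1 x2 x3 x4 x5 x6.
  rewrite !ler_norml => /andP[? ?] /andP[? ?] /andP[? ?]; apply/andP; split; lra.
have -> : g s - h^-1 *: (f (h *: 1 + s) - f s) =
  - (h^-1 * ((f (h *: 1 + s) - f s) - (F (h *: 1 + s) - F s)))
  + (G s - h^-1 *: (F (h *: 1 + s) - F s)) - (G s - g s).
  by rewrite /GRing.scale /=; ring.
apply: le_trans (ler_normB _ _) _.
apply: le_trans (lerD (ler_normD _ _) (lexx _)) _.
have := (FG s).2; rewrite normrN normrM normfV.
have : `|h|^-1 * `|(f (h *: (1 : R) + s) - f s) - (F (h *: (1 : R) + s) - F s)| <= e / 2.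
  by rewrite ler_pdivrMl.
lra.
Qed.

Lemma cderiv_unif (f g : R -> C) :
  (forall e, 0 < e -> exists F G : R -> C, cderiv F G /\
    forall s, normc (F s - f s) <= e /\ normc (G s - g s) <= e) ->
  cderiv f g.
Proof.
have ReB z w : Re (z - w) = Re z - Re w by case: z w => ? ? [].
have ImB z w : Im (z - w) = Im z - Im w by case: z w => ? ? [].
move=> H s; split.
- apply: (@is_derive_unif (fun t => Re (f t)) (fun t => Re (g t))) => e /H[F [G [dF FG]]].
  exists (fun t => Re (F t)), (fun t => Re (G t)); split=> [t|t].
    by have [] := dF t.
  by rewrite -!ReB; have [h1 h2] := FG t; split;
    apply: le_trans (normc_Re _) _.
- apply: (@is_derive_unif (fun t => Im (f t)) (fun t => Im (g t))) => e /H[F [G [dF FG]]].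
  exists (fun t => Im (F t)), (fun t => Im (G t)); split=> [t|t].
    by have [] := dF t.
  by rewrite -!ImB; have [h1 h2] := FG t; split;
    apply: le_trans (normc_Im _) _.
Qed.

Definition geo m : R := 2^-1 ^+ m.

Lemma geo_gt0 m : 0 < geo m.
Proof. by rewrite exprn_gt0 // invr_gt0. Qed.

Lemma geoS m : geo m.+1 = geo m / 2.
Proof. by rewrite /geo exprSr. Qed.

Lemma geo_small (e : R) : 0 < e -> exists m, geo m <= e.
Proof.
move=> e0; have /cvgrPdist_le/(_ e e0) : geo m @[m --> \oo] --> (0 : R).
  by apply: cvg_expr; rewrite ger0_norm; lra.
case=> m _ /(_ m (leqnn m)); rewrite sub0r normrN (ger0_norm (ltW (geo_gt0 m))) => h.
by exists m.
Qed.

Lemma geo_small_mul (D e : R) : 0 <= D -> 0 < e -> exists m, D * geo m <= e.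
Proof.
move=> D0 e0; have [|m hm] := @geo_small (e / (D + 1)); first by rewrite divr_gt0 //; lra.
exists m; rewrite ler_pdivlMr in hm; last lra.
have := geo_gt0 m; lra.
Qed.

Lemma le_geo_limit (x y D : R) : (forall m, x <= y + D * geo m) -> x <= y.
Proof.
move=> H; apply/ler_addgt0Pr => e e0.
have [m hm] := @geo_small_mul `|D| e (normr_ge0 _) e0.
apply: le_trans (H m) _; rewrite lerD2l; apply: le_trans hm.
by rewrite ler_wpM2r ?ler_norm // ltW ?geo_gt0.
Qed.

(** The numbers [x m - D * geo m] increase, the numbers [x m + D * geo m]
    decrease, and the limit is the supremum of the former. *)
Lemma geo_cauchy (x : nat -> R) (D : R) :
  (forall m, `|x m.+1 - x m| <= D * geo m.+1) ->
  exists l, forall m, `|x m - l| <= D * geo m.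
Proof.
move=> H.
have D0 : 0 <= D by have := le_trans (normr_ge0 _) (H 0%N); rewrite pmulr_lge0 ?geo_gt0.
have lo m k : x m - D * geo m <= x (m + k)%N - D * geo (m + k)%N.
  elim: k => [|k IH]; first by rewrite addn0.
  apply: le_trans IH _; rewrite addnS; have := H (m + k)%N; rewrite geoS ler_norml => /andP[? ?]; lra.
have up m k : x (m + k)%N + D * geo (m + k)%N <= x m + D * geo m.
  elim: k => [|k IH]; first by rewrite addn0.
  apply: le_trans IH; rewrite addnS; have := H (m + k)%N; rewrite geoS ler_norml => /andP[? ?]; lra.
have cross m k : x m - D * geo m <= x k + D * geo k.
  have := lo m k; have := up k m; rewrite addnC.
  have := mulr_ge0 D0 (ltW (geo_gt0 (m + k))); lra.
pose E := range (fun m => x m - D * geo m).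
have E0 : E !=set0 by exists (x 0%N - D * geo 0); exists 0%N.
exists (sup E) => m; rewrite ler_norml; apply/andP; split.
  have : sup E <= x m + D * geo m.
    by apply: ge_sup => // _ [k _ <-].
  lra.
have : x m - D * geo m <= sup E.
  apply: ub_le_sup; last by exists m.
  by exists (x 0%N + D * geo 0) => _ [k _ <-].
lra.
Qed.

Lemma geo_cauchyc (z : nat -> C) (D : R) :
  (forall m, normc (z m.+1 - z m) <= D * geo m.+1) ->
  exists l, forall m, normc (z m - l) <= 2 * D * geo m.
Proof.
have ReB z1 w : Re (z1 - w) = Re z1 - Re w by case: z1 w => ? ? [].
have ImB z1 w : Im (z1 - w) = Im z1 - Im w by case: z1 w => ? ? [].
move=> H.
have [|x hx] := @geo_cauchy (fun m => Re (z m)) D.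
  by move=> m; rewrite -ReB; apply: le_trans (normc_Re _) _.
have [|y hy] := @geo_cauchy (fun m => Im (z m)) D.
  by move=> m; rewrite -ImB; apply: le_trans (normc_Im _) _.
exists (Complex x y) => m; apply: le_trans (normc_le _) _; rewrite ReB ImB /=.
have := hx m; have := hy m; lra.
Qed.

End Limits.

(** * Solving the nonlinear problem by successive corrections *)

Section Newton.
Variable R : realType.
Local Notation C := R[i].
Local Notation normc := (@Normc.normc R).
Implicit Types (u v : R -> C) (b : R).

Variables (a L : R) (DF : (R -> C) -> R -> C).
Hypotheses (a_gt0 : 0 < a) (L_ge0 : 0 <= L).
Hypothesis DFD : forall u v s, DF (fun t => u t + v t) s = DF u s + DF v s.
Hypothesis DF_lip : forall u v (h : R), (forall s, normc (u s - v s) <= h) ->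
  forall s, normc (DF u s - DF v s) <= L * h.

Definition linop u u' b s : C :=
  a%:C%C * (u s - 'i%C * u' s) - DF u s + b%:C%C * mode (- 1) s.

Variable K : R.
Hypothesis solve : forall N c (M : R), 0 < M ->
  (forall s, normc (realpoly N c s) <= M) ->
  exists v v' b, [/\ trigpoly v, reversible v, cderiv v v',
    linop v v' b =1 realpoly N c & (forall s, normc (v s) <= K * M) /\ `|b| <= K * M].

Variables (W : (R -> C) -> R -> R -> C) (rho eta kap : R).
Hypotheses (rho_gt0 : 0 < rho) (eta_gt0 : 0 < eta).
Hypotheses (Keta : K * eta * 5 <= rho * 2) (Kkap : K * kap * 5 <= 1).
Hypothesis W0 : forall s, normc (W (fun=> 0) 0 s) <= eta.
Hypothesis W_lip : forall u v b b1 (h : R),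
  (forall s, normc (u s) <= rho) -> (forall s, normc (v s) <= rho) ->
  `|b| <= rho -> `|b1| <= rho ->
  (forall s, normc (u s - v s) <= h) -> `|b - b1| <= h ->
  forall s, normc (W u b s - W v b1 s) <= kap * h.
Hypothesis W_approx : forall u b, trigpoly u -> reversible u ->
  (forall s, normc (u s) <= rho) -> `|b| <= rho ->
  approximable (W u b) /\ reversible (W u b).

Let state := ((R -> C) * (R -> C) * R)%type.

Let inv m (x : state) := let: (u, u', b) := x in
  [/\ [/\ trigpoly u, reversible u & cderiv u u'],
      trigpoly (linop u u' b) /\ reversible (linop u u' b),
      (forall s, normc (u s) <= rho * (1 - geo R m)), `|b| <= rho * (1 - geo R m) &
      forall s, normc (W u b s - linop u u' b s) <= eta * geo R m].

Let close m (x y : state) := let: (u, _, b) := x in let: (v, _, b1) := y in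
  (forall s, normc (v s - u s) <= rho * geo R m.+1) /\ `|b1 - b| <= rho * geo R m.+1.

Let le_rho (x : R) m : x <= rho * (1 - geo R m) -> x <= rho.
Proof. by move=> h; apply: le_trans h _; rewrite ler_piMr ?(ltW rho_gt0) // gerBl (ltW (geo_gt0 R m)). Qed.

Let linopD u u' b v v' b1 s :
  linop (fun t => u t + v t) (fun t => u' t + v' t) (b + b1) s =
  linop u u' b s + linop v v' b1 s.
Proof. by rewrite /linop DFD rmorphD /=; ring. Qed.

(** Solving the linear problem for a trigonometric approximation of the
    residual at least halves the residual, since the nonlinearity is a weak
    contraction compared with the inverse of the linear part. *)
Let improve m x : inv m x -> exists y, inv m.+1 y /\ close m x y.
Proof.
case: x => [[u u'] b] [[tu ru du] [tX rX] u_le b_le res].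
have g0 := geo_gt0 R m.
have ur s := le_rho (u_le s). have br := le_rho b_le.
have [aW rW] := W_approx tu ru ur br.
have e0 : 0 < eta * geo R m / 4 by rewrite divr_gt0 ?mulr_gt0.
have [||N [c pc]] := @approx_reversible _ (fun s => W u b s - linop u u' b s) _ _ _ e0.
- have -> : (fun s => W u b s - linop u u' b s) = (fun s => W u b s + (-1) * linop u u' b s).
    by apply/funext => s; rewrite mulN1r.
  by apply: approxD => //; apply/approxZ/approx_trigpoly.
- by move=> s; rewrite conjcB rW rX.
pose M := eta * geo R m * 5 / 4.
have [||v [v' [b1 [tv rv dv lv [v_le b1_le]]]]] := @solve N c M.
- by rewrite /M; lra.
- move=> s.
  have -> : realpoly N c s = (W u b s - linop u u' b s)
      - (W u b s - linop u u' b s - realpoly N c s) by ring.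
  by apply: le_trans (le_normcB _ _) _; have := pc s; have := res s; rewrite /M; lra.
have KM : K * M <= rho * geo R m.+1.
  rewrite geoS /M; have := ler_wpM2r (ltW g0) Keta; lra.
have kM : kap * (K * M) <= eta * geo R m / 4.
  have := ler_wpM2r (ltW e0) Kkap; rewrite /M; lra.
have v_le1 s : normc (v s) <= rho * geo R m.+1 by exact: le_trans (v_le s) KM.
have b1_le1 := le_trans b1_le KM.
have uv s : normc (u s + v s) <= rho * (1 - geo R m.+1).
  apply: le_trans (le_normcD _ _) _; have := u_le s; have := v_le1 s; rewrite geoS; lra.
have bb : `|b + b1| <= rho * (1 - geo R m.+1).
  apply: le_trans (ler_normD _ _) _; have := b_le; have := b1_le1; rewrite geoS; lra.
exists (fun s => u s + v s, fun s => u' s + v' s, b + b1); split.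
  have XE : linop (fun s => u s + v s) (fun s => u' s + v' s) (b + b1) =
      fun s => linop u u' b s + realpoly N c s.
    by apply/funext => s; rewrite linopD lv.
  split=> //.
  - split; [exact: trigpolyD| |exact: cderivD].
    by move=> s; rewrite conjcD ru rv.
  - rewrite XE; split; first exact/trigpolyD/trigpoly_realpoly.
    by move=> s; rewrite conjcD rX reversible_realpoly.
  - move=> s; rewrite XE.
    have -> : W (fun t => u t + v t) (b + b1) s - (linop u u' b s + realpoly N c s) =
      (W (fun t => u t + v t) (b + b1) s - W u b s) +
      (W u b s - linop u u' b s - realpoly N c s) by ring.
    apply: le_trans (le_normcD _ _) _.
    have : normc (W (fun t => u t + v t) (b + b1) s - W u b s) <= kap * (K * M).
      apply: W_lip => // [t||t|].
      - exact: le_rho (uv t).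
      - exact: le_rho bb.
      - by rewrite addrAC subrr add0r.
      - by rewrite addrAC subrr add0r.
    have := pc s; rewrite geoS; lra.
by split=> [s|]; rewrite addrAC subrr add0r.
Qed.

Let DF0 s : DF (fun=> 0) s = 0.
Proof.
have := DFD (fun=> 0) (fun=> 0) s.
under eq_fun do rewrite addr0.
by move=> /esym/eqP; rewrite -subr_eq0 addrK => /eqP.
Qed.

(** The derivative of the limit is read off from the equation itself, so that
    the uniform convergence of the derivatives follows from that of the
    functions and of the residuals. *)
Lemma weakly_nonlinear_solution : exists u v b, [/\ cderiv u v, forall s, u (s + pi *+ 2) = u s,
  forall s, normc (u s) <= rho, `|b| <= rho & linop u v b =1 W u b].
Proof.
have [f fP] : {f & forall x : nat * state, inv x.1 x.2 ->
    inv x.1.+1 (f x) /\ close x.1 x.2 (f x)}.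
  apply: (@choice _ _ (fun x y => inv x.1 x.2 -> inv x.1.+1 y /\ close x.1 x.2 y)) => x.
  have [/improve[y yP]|no] := pselect (inv x.1 x.2); first by exists y.
  by exists x.2 => /no.
pose fix st m : state := if m is k.+1 then f (k, st k) else (fun=> 0, fun=> 0, 0).
have stP m : inv m (st m).
  elim: m => [|m IH]; last by have [] := fP (m, st m) IH.
  have l0 : linop (fun=> 0) (fun=> 0) 0 = fun=> 0.
    by apply/funext => s; rewrite /linop DF0 rmorph0 !(mulr0, mul0r, subrr, addr0).
  rewrite /= l0; split.
  - split; [exact: trigpoly_cst| |exact: cderiv_cst].
    by move=> s; rewrite conjc0.
  - by split; [exact: trigpoly_cst|move=> s; rewrite conjc0].
  - by move=> s; rewrite expr0n addr0 sqrtr0 /geo expr0 subrr mulr0.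
  - by rewrite normr0 /geo expr0 subrr mulr0.
  - by move=> s; rewrite subr0 /geo expr0 mulr1.
have stC m : close m (st m) (st m.+1) by have [] := fP (m, st m) (stP m).
pose U m := (st m).1.1; pose U' m := (st m).1.2; pose B m := (st m).2.
have UC m s : normc (U m.+1 s - U m s) <= rho * geo R m.+1.
  by have := stC m; rewrite /U; case: (st m) (st m.+1) => [[? ?] ?] [[? ?] ?] [].
have BC m : `|B m.+1 - B m| <= rho * geo R m.+1.
  by have := stC m; rewrite /B; case: (st m) (st m.+1) => [[? ?] ?] [[? ?] ?] [].
have UP m : inv m (U m, U' m, B m).
  by have := stP m; rewrite /U /U' /B; case: (st m) => [[? ?] ?].
have [u uP] : {u & forall s, forall m, normc (U m s - u s) <= 2 * rho * geo R m}.
  apply: (@choice _ _ (fun s z => forall m, normc (U m s - z) <= 2 * rho * geo R m)) => s.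
  by apply: geo_cauchyc => m; exact: UC.
have [b bP1] := geo_cauchy BC.
have bP m : `|B m - b| <= 2 * rho * geo R m.
  by apply: le_trans (bP1 m) _; have := mulr_gt0 rho_gt0 (geo_gt0 R m); lra.
have u_le s : normc (u s) <= rho.
  apply: (@le_geo_limit _ _ _ (2 * rho)) => m.
  have [_ _ h _ _] := UP m.
  have -> : u s = U m s - (U m s - u s) by ring.
  by apply: le_trans (le_normcB _ _) _; apply: lerD (le_rho (h s)) (uP s m).
have b_le : `|b| <= rho.
  apply: (@le_geo_limit _ _ _ (2 * rho)) => m.
  have [_ _ _ h _] := UP m.
  have -> : b = B m - (B m - b) by ring.
  by apply: le_trans (ler_normB _ _) _; apply: lerD (le_rho h) (bP m).
have aC : a%:C%C != 0 :> C by rewrite -normc_eq0 normc_real normr_eq0 gt_eqF.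
have ii : 'i%C * 'i%C = -1 :> C by rewrite -expr2 sqr_i.
pose V w c X s : C := 'i%C / a%:C%C * (X s - c%:C%C * mode (- 1) s + DF w s - a%:C%C * w s).
have VE w c X : linop w (V w c X) c =1 X.
  move=> s; rewrite /linop /V.
  set Y := X s - _ + _ - _.
  have -> : a%:C%C * (w s - 'i%C * ('i%C / a%:C%C * Y)) = a%:C%C * w s - ('i%C * 'i%C) * Y.
    by field.
  by rewrite ii /Y; ring.
pose v := V u b (W u b).
exists u, v, b; split=> //; last exact: VE.
- apply: cderiv_unif => e e0.
  pose D := a^-1 * (eta + kap * (2 * rho) + 2 * rho + L * (2 * rho) + a * (2 * rho)) + 2 * rho.
  have [m hm] := geo_small_mul (normr_ge0 D) e0.
  have g0 := geo_gt0 R m.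
  have {hm} hD : D * geo R m <= e.
    by apply: le_trans hm; rewrite ler_wpM2r ?ler_norm // ltW.
  have ia : 0 < a^-1 by rewrite invr_gt0.
  have [[_ _ dU] _ Ule Ble Ures] := UP m.
  exists (U m), (U' m); split=> // s.
  have Wu : normc (W (U m) (B m) s - W u b s) <= kap * (2 * rho * geo R m).
    apply: W_lip => //; [by move=> t; exact: le_rho (Ule t)|exact: le_rho Ble].
  have kap_ge0 : 0 <= kap.
    have := le_trans (normc_ge0 _) Wu.
    by rewrite pmulr_lge0 // mulr_gt0 // mulr_gt0.
  have Dge : 2 * rho * geo R m <= e.
    apply: le_trans hD; rewrite ler_wpM2r ?(ltW g0) // /D lerDr.
    by rewrite mulr_ge0 ?(ltW ia) // !addr_ge0 ?mulr_ge0 ?(ltW rho_gt0) ?(ltW eta_gt0) ?(ltW a_gt0).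
  split; first exact: le_trans (uP s m) Dge.
  have -> : U' m s - v s = 'i%C / a%:C%C *
     ((linop (U m) (U' m) (B m) s - W (U m) (B m) s) + (W (U m) (B m) s - W u b s)
      - (B m - b)%:C%C * mode (- 1) s + (DF (U m) s - DF u s) - a%:C%C * (U m s - u s)).
    have -> : U' m s = - ('i%C * 'i%C) * U' m s by rewrite ii opprK mul1r.
    rewrite /v /V /linop rmorphB /=.
    by field.
  rewrite !Normc.normcM Normc.normcV normc_real (gtr0_norm a_gt0).
  have -> : normc ('i%C : C) = 1.
    by rewrite /Normc.normc /= expr0n expr1n add0r sqrtr1.
  rewrite mul1r.
  apply: le_trans (_ : a^-1 * (eta * geo R m + kap * (2 * rho * geo R m)
     + 2 * rho * geo R m + L * (2 * rho * geo R m) + a * (2 * rho * geo R m)) <= _).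
    rewrite ler_pM2l //.
    apply: le_trans (le_normcB _ _) _; apply: lerD; last first.
      rewrite Normc.normcM normc_real (gtr0_norm a_gt0) ler_pM2l //; exact: uP.
    apply: le_trans (le_normcD _ _) _; apply: lerD; last by apply: DF_lip => t; exact: uP.
    apply: le_trans (le_normcB _ _) _; apply: lerD; last first.
      by rewrite Normc.normcM normc_real normc_mode mulr1.
    apply: le_trans (le_normcD _ _) _; apply: lerD => //.
    by rewrite normc_distC.
  apply: le_trans hD.
  have -> : a^-1 * (eta * geo R m + kap * (2 * rho * geo R m) + 2 * rho * geo R m +
     L * (2 * rho * geo R m) + a * (2 * rho * geo R m)) =
     a^-1 * (eta + kap * (2 * rho) + 2 * rho + L * (2 * rho) + a * (2 * rho)) * geo R m by ring.
  by apply: ler_wpM2r; [exact: ltW|rewrite /D lerDl mulr_ge0 // ltW].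
- move=> s; apply/eqP; rewrite -subr_eq0 -normc_eq0 eq_le normc_ge0 andbT.
  apply: (@le_geo_limit _ _ _ (4 * rho)) => m; rewrite add0r.
  have [[[l lE] _ _] _ _ _ _] := UP m.
  have Uper : U m (s + pi *+ 2) = U m s.
    rewrite !lE; apply: eq_bigr => k _; rewrite modeDr /mode.
    by rewrite expi2piz mulr1.
  have -> : u (s + pi *+ 2) - u s = (U m s - u s) - (U m (s + pi *+ 2) - u (s + pi *+ 2)).
    by rewrite Uper; ring.
  by apply: le_trans (le_normcB _ _) _; have := uP s m; have := uP (s + pi *+ 2) m; lra.
Qed.

End Newton.

(** * The ring of vortices *)

Section Ring.
Variables (R : realType) (m : nat).
Local Notation C := R[i].
Local Notation normc := (@Normc.normc R).
Local Notation Re := (@complex.Re R).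
Local Notation Im := (@complex.Im R).
Local Notation n := m.+2.
Implicit Types (s t : R) (l j : 'I_n) (u v : R -> C).

Definition angle l : R := l%:R * (pi *+ 2) / n%:R.

Definition root l : C := expi (angle l).

Let n0 : n%:R != 0 :> R. Proof. by rewrite pnatr_eq0. Qed.

Lemma angle0 : angle 0 = 0.
Proof. by rewrite /angle mul0r mul0r. Qed.

Lemma angleD l j : exists k : int, angle (l + j) = angle l + angle j + k%:~R * (pi *+ 2).
Proof.
exists (- ((l + j)%/ n)%N%:Z).
have /(congr1 (fun x : nat => x%:R : R)) := divn_eq (l + j) n.
rewrite !natrD natrM => h.
rewrite /angle /= mulrNz -[(_ %/ _)%:Z%:~R]/((_ %/ _)%N%:R).
have -> : (((l + j) %% n)%N)%:R = l%:R + j%:R - ((l + j) %/ n)%N%:R * n%:R :> R.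
  by rewrite h; ring.
by field.
Qed.

Lemma angleN l : exists k : int, angle (- l) = - angle l + k%:~R * (pi *+ 2).
Proof.
have [k] := angleD (- l) l; rewrite addNr angle0 => h.
by exists (- k); rewrite mulrNz; move: h; lra.
Qed.

Definition turn_periodic (T : Type) (f : R -> T) := forall s, f (s + pi *+ 2) = f s.

Lemma turn_periodicz (T : Type) (f : R -> T) : turn_periodic f ->
  forall s (k : int), f (s + k%:~R * (pi *+ 2)) = f s.
Proof.
move=> fp s k.
have pos t (j : nat) : f (t + j%:R * (pi *+ 2)) = f t.
  elim: j => [|j IH]; first by rewrite mul0r addr0.
  by rewrite -natr1 mulrDl mul1r addrA fp.
case: k => j; first exact: pos.
rewrite NegzE mulrNz -[X in f X](addrK (j.+1%:R * (pi *+ 2))).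
rewrite -[in LHS](pos _ j.+1); congr f.
rewrite -[_%:~R]/(j.+1%:R); ring.
Qed.

Lemma mode_periodic k : turn_periodic (@mode R k).
Proof. by move=> s; rewrite modeDr /mode expi2piz mulr1. Qed.

Lemma expi_periodic : turn_periodic (@expi R).
Proof. by move=> s; rewrite expiD expi2pi mulr1. Qed.

Lemma trigpoly_periodic u : trigpoly u -> turn_periodic u.
Proof.
by move=> [c uc] s; rewrite !uc; apply: eq_bigr => k _; rewrite mode_periodic.
Qed.

Lemma periodic_angleN (T : Type) (f : R -> T) : turn_periodic f ->
  forall s l, f (s - angle (- l)) = f (s + angle l).
Proof.
move=> fp s l; have [k ->] := angleN l.
rewrite -(turn_periodicz fp (s + angle l) (- k)) mulrNz; congr f; ring.
Qed.

Lemma mode_angleN k l : mode k (angle (- l)) = conjc (mode k (angle l)).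
Proof.
have [j ->] := angleN l.
by rewrite (turn_periodicz (@mode_periodic k)) mode_oppr.
Qed.

Lemma rootN l : root (- l) = conjc (root l).
Proof. by rewrite /root -!mode1 mode_angleN. Qed.

Lemma normc_root l : normc (root l) = 1.
Proof. exact: normc_expi. Qed.

Lemma root_neq1 l : l != 0 -> 1 - root l != 0.
Proof.
move=> l0; rewrite subr_eq0 eq_sym; apply: expi_eq1.
have p2 : 0 < pi *+ 2 :> R by rewrite pmulrn_rgt0 // pi_gt0.
have l1 : (0 < l)%N by rewrite lt0n; apply: contra l0 => /eqP h; apply/eqP/val_inj.
rewrite /angle divr_gt0 ?mulr_gt0 ?ltr0n //=.
by rewrite ltr_pdivrMr ?ltr0n // mulrC ltr_pM2l // ltr_nat.
Qed.

(** The reflection of the ring through its zeroth vertex. *)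
Lemma sum_ringN (V : nmodType) (F : 'I_n -> V) :
  \sum_(l | l != 0) F (- l) = \sum_(l | l != 0) F l.
Proof.
rewrite [RHS](reindex_inj oppr_inj) /=.
by apply: eq_bigl => l; rewrite oppr_eq0.
Qed.

Lemma sum_ring_odd (F : 'I_n -> R) : (forall l, F (- l) = - F l) ->
  \sum_(l | l != 0) F l = 0.
Proof.
move=> odd; have := sum_ringN F; under eq_bigr do rewrite odd.
rewrite sumrN => h; lra.
Qed.

Lemma card_ring : #|[pred l : 'I_n | l != 0]| = m.+1.
Proof.
by have := cardC1 (0 : 'I_n); rewrite card_ord.
Qed.

Definition chord2 l : R := 2 - 2 * cos (angle l).

Lemma chord2E l : normc (1 - root l) ^+ 2 = chord2 l.
Proof.
rewrite sqr_normcE /root /expi /chord2 /= sub0r sqrrN.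
have := cos2Dsin2 (angle l); set c := cos _; set d := sin _ => h.
transitivity (1 - 2 * c + (c ^+ 2 + d ^+ 2)); first ring.
by rewrite h; ring.
Qed.

Lemma chord2_gt0 l : l != 0 -> 0 < chord2 l.
Proof. by move=> l0; rewrite -chord2E exprn_gt0 // normc_gt0 root_neq1. Qed.

(** The angular speed of the regular [n]-gon of unit radius when
    [lambda = 1], without confinement. *)
Definition ring_speed : R := m.+1%:R / 2.

Lemma ring_speed_gt0 : 0 < ring_speed.
Proof. by rewrite divr_gt0 ?ltr0n. Qed.

Lemma invc_1Broot l : l != 0 ->
  (1 - root l)^-1 = Complex (1 / 2) (sin (angle l) / chord2 l).
Proof.
move=> l0; have c0 := chord2_gt0 l0.
apply: (mulfI (root_neq1 l0)); rewrite divff ?root_neq1 //.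
have := cos2Dsin2 (angle l); rewrite /chord2 in c0 *.
rewrite /root /expi; set c := cos _; set d := sin _ => h.
have h2 : d ^+ 2 = 1 - c ^+ 2 by rewrite -h; ring.
have c1 : 2 - 2 * c != 0 by rewrite gt_eqF.
apply: eq_ReIm; rewrite ?Re_mul ?Im_mul /=.
  transitivity ((1 - c) * (1 / 2) + d ^+ 2 / (2 - 2 * c)); first by rewrite h2; field.
  by ring.
by field.
Qed.

Lemma sum_invc_1Broot : \sum_(l | l != 0) (1 - root l)^-1 = ring_speed%:C%C.
Proof.
under eq_bigr => l l0 do rewrite (invc_1Broot l0).
apply: eq_ReIm; rewrite ?Re_sum ?Im_sum /=.
  by rewrite sumr_const card_ring -[LHS]mulr_natr /ring_speed; lra.
apply: sum_ring_odd => l; have [k h] := angleN l.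
have := mode_angleN 1 l; rewrite !mode1 /expi => -[hc hs].
by rewrite /chord2 hc hs mulNr.
Qed.

(** The off-diagonal coefficient of the linearised interaction, which sends the
    mode [k] to the mode [- k]. *)
Definition coupling (k : int) : R :=
  \sum_(l | l != 0) (cos (angle l) - cos (k%:~R * angle l)) / chord2 l.

Lemma couplingN k : coupling (- k) = coupling k.
Proof. by apply: eq_bigr => l _; rewrite mulrNz mulNr cosN. Qed.

Lemma coupling1 : coupling 1 = 0.
Proof. by rewrite /coupling big1 // => l _; rewrite mul1r subrr mul0r. Qed.

Lemma coupling0 : coupling 0 = - ring_speed.
Proof.
rewrite /coupling (eq_bigr (fun=> - (1 / 2))) => [|l l0].
  by rewrite sumr_const card_ring -[LHS]mulr_natr /ring_speed; lra.
have := chord2_gt0 l0; rewrite mul0r cos0 /chord2; set c := cos _ => c0.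
have c1 : 2 - 2 * c != 0 by rewrite gt_eqF.
by field.
Qed.

Lemma coupling_le k : `|coupling k| <= \sum_(l | l != 0) 2 / chord2 l.
Proof.
apply: le_trans (ler_norm_sum _ _ _) _; apply: ler_sum => l l0.
have c0 := chord2_gt0 l0.
rewrite normrM normfV (gtr0_norm c0) ler_pM2r ?invr_gt0 //.
apply: le_trans (ler_normB _ _) _.
by have := cos_max (angle l); have := cos_max (k%:~R * angle l); lra.
Qed.

(** The left side is real because the reflection of the ring conjugates
    [root l] and [mode k (angle l)]. *)
Lemma couplingE k : \sum_(l | l != 0)
  - ((1 - root l * mode k (angle l)) / (1 - root l) ^+ 2) = (coupling k)%:C%C.
Proof.
have termE l : l != 0 -> - ((1 - root l * mode k (angle l)) / (1 - root l) ^+ 2) =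
    Complex ((cos (angle l) - cos (k%:~R * angle l)) / chord2 l)
      ((- sin (angle l) - sin (k%:~R * angle l)) / chord2 l).
  move=> l0; have N0 := chord2_gt0 l0.
  have rr : root l * conjc (root l) = 1.
    by rewrite mulc_conj normc_root expr1n.
  (* [(1 - z) ^+ 2 = - z * |1 - z| ^+ 2] on the unit circle. *)
  have NE : (1 - root l) ^+ 2 = - root l * (chord2 l)%:C%C.
    rewrite -chord2E -mulc_conj conjcB conjc1.
    transitivity (- root l * (1 - root l) + (root l * conjc (root l)) * (1 - root l)).
      by rewrite rr; ring.
    by ring.
  have NC : (chord2 l)%:C%C != 0 :> C by rewrite -normc_eq0 normc_real normr_eq0 gt_eqF.
  have r0 : root l != 0 by exact: expi_neq0.
  transitivity ((conjc (root l) - mode k (angle l)) * ((chord2 l)^-1)%:C%C).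
    rewrite NE fmorphV.
    transitivity ((root l * conjc (root l) - root l * mode k (angle l)) /
                  (root l * (chord2 l)%:C%C)).
      by rewrite rr; field; rewrite r0 NC.
    by field; rewrite r0 NC.
  by rewrite mulrC; apply: eq_ReIm; rewrite ?Re_scale ?Im_scale /= [LHS]mulrC.
under eq_bigr => l l0 do rewrite (termE l l0).
apply: eq_ReIm; rewrite ?Re_sum ?Im_sum //=.
apply: sum_ring_odd => l.
have := mode_angleN 1 l; rewrite !mode1 /expi => -[hc hs].
have := mode_angleN k l; rewrite /mode /expi => -[hc2 hs2].
by rewrite /chord2 hc hs hs2; ring.
Qed.

(** * The interaction *)

(** With [q s = c + r e^(is) (1 + u s)], the conjugate of the difference
    [q s - q (s - angle l)] is [r e^(-is)] times [1 - root l + gap u l s]. *)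
Definition gap u l s : C := conjc (u s) - root l * conjc (u (s - angle l)).

(** The interaction is expanded to first order in [u]. *)
Definition lin_inter u s : C := - \sum_(l | l != 0) gap u l s / (1 - root l) ^+ 2.

Definition quad_inter u s : C := \sum_(l | l != 0)
  ((1 - root l + gap u l s)^-1 - (1 - root l)^-1 + gap u l s / (1 - root l) ^+ 2).

Lemma interE u s : \sum_(l | l != 0) (1 - root l + gap u l s)^-1 =
  ring_speed%:C%C + lin_inter u s + quad_inter u s.
Proof.
rewrite -sum_invc_1Broot /lin_inter -sumrN -!big_split /=.
by apply: eq_bigr => l _; ring.
Qed.

Lemma gapD u v l s : gap (fun t => u t + v t) l s = gap u l s + gap v l s.
Proof. by rewrite /gap !conjcD; ring. Qed.

Lemma gap_lip u v l (h : R) : (forall s, normc (u s - v s) <= h) ->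
  forall s, normc (gap u l s - gap v l s) <= 2 * h.
Proof.
move=> uv s.
have -> : gap u l s - gap v l s =
   conjc (u s - v s) - root l * conjc (u (s - angle l) - v (s - angle l)).
  by rewrite /gap !conjcB; ring.
apply: le_trans (le_normcB _ _) _.
rewrite Normc.normcM normc_root mul1r !normc_conj.
by have := uv s; have := uv (s - angle l); lra.
Qed.

Lemma gap_le u l (h : R) : (forall s, normc (u s) <= h) ->
  forall s, normc (gap u l s) <= 2 * h.
Proof.
move=> uh s; apply: le_trans (le_normcB _ _) _.
rewrite Normc.normcM normc_root mul1r !normc_conj.
by have := uh s; have := uh (s - angle l); lra.
Qed.

Lemma gap_trigpoly u l : trigpoly u -> trigpoly (gap u l).
Proof.
move=> tu.
have -> : gap u l = fun s => conjc (u s) + - root l * conjc (u (s - angle l)).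
  by apply/funext => s; rewrite mulNr.
apply: trigpolyD; first exact: trigpoly_conj.
by apply: trigpolyZ; exact: (trigpoly_shift (- angle l) (trigpoly_conj tu)).
Qed.

Lemma gap_reversible u l s : turn_periodic u -> reversible u ->
  gap u (- l) (- s) = conjc (gap u l s).
Proof.
move=> pu ru; rewrite /gap conjcB conjcM !conjcK rootN.
by rewrite periodic_angleN // -!ru opprD !opprK.
Qed.

Lemma lin_interD u v s :
  lin_inter (fun t => u t + v t) s = lin_inter u s + lin_inter v s.
Proof.
rewrite /lin_inter -opprD -big_split /=; congr (- _).
by apply: eq_bigr => l _; rewrite gapD mulrDl.
Qed.

Lemma lin_inter_lip u v (h : R) : (forall s, normc (u s - v s) <= h) ->
  forall s, normc (lin_inter u s - lin_inter v s) <=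
            (\sum_(l | l != 0) 2 / chord2 l) * h.
Proof.
move=> uv s.
have -> : lin_inter u s - lin_inter v s =
    - \sum_(l | l != 0) (gap u l s - gap v l s) / (1 - root l) ^+ 2.
  rewrite /lin_inter -opprD -sumrN -big_split /=; congr (- _).
  by apply: eq_bigr => l _; ring.
rewrite normcN; apply: le_trans (normc_sum _ _ _) _.
rewrite mulr_suml; apply: ler_sum => l l0.
rewrite Normc.normcM Normc.normcV normcX chord2E mulrAC.
by rewrite ler_pM2r ?invr_gt0 ?chord2_gt0 //; exact: gap_lip.
Qed.

Lemma lin_inter_realpoly N c s :
  lin_inter (realpoly N c) s = \sum_(k <- zrange N) (coupling k * c (- k))%:C%C * mode k s.
Proof.
have gapE l : gap (realpoly N c) l s =
    \sum_(k <- zrange N) (c k)%:C%C * mode (- k) s * (1 - root l * mode k (angle l)).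
  rewrite /gap /realpoly !conjc_sum mulr_sumr -sumrB; apply: eq_bigr => k _.
  by rewrite !conjcM !conjcR modeDr mode_oppr conjcM conjcK -modeN; ring.
rewrite /lin_inter; under eq_bigr do rewrite gapE mulr_suml.
rewrite exchange_big /= -sumrN -[RHS]sum_zrangeN; apply: eq_bigr => k _.
rewrite opprK couplingN rmorphM /= -couplingE mulr_suml mulr_suml -sumrN.
by apply: eq_bigr => l _; ring.
Qed.

End Ring.

Arguments angle {R m} l.
Arguments root {R m} l.
Arguments chord2 {R m} l.

(** * Existence of the ring curve *)

Section RingCurve.
Variables (R : realType) (m : nat).
Local Notation C := R[i].
Local Notation normc := (@Normc.normc R).
Local Notation n := m.+2.
Implicit Types (s t : R) (l : 'I_n) (u v : R -> C).

(** The inverse of the sum of all inverses is below each term, so no minimum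
    has to be chosen. *)
Lemma root_gap : exists2 d : R, 0 < d &
  forall l, l != 0 -> d <= normc (1 - root l).
Proof.
pose S : R := \sum_(l : 'I_n | l != 0) (normc (1 - root l))^-1.
have pos l : l != 0 -> 0 < (normc (1 - root l))^-1.
  by move=> l0; rewrite invr_gt0 normc_gt0 root_neq1.
have S0 : 0 <= S by apply: sumr_ge0 => l l0; rewrite ltW ?pos.
exists (1 + S)^-1 => [|l l0]; first by rewrite invr_gt0; lra.
rewrite -[leRHS]invrK lef_pV2 ?posrE ?pos //; last by lra.
rewrite /S (bigD1 l) //=.
have : 0 <= \sum_(i < n | (i != 0) && (i != l)) (normc (1 - root i))^-1 :> R.
  by apply: sumr_ge0 => i /andP[i0 _]; rewrite ltW ?pos.
lra.
Qed.

(** The two remainders differ by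
    [(x - y) (d (x + y) + x y) / (d ^+ 2 (d + x) (d + y))]; the second factor
    makes the Lipschitz constant proportional to the size [e] of [x] and [y]. *)
Lemma quad_term_lip (d x y : C) (e : R) : d != 0 -> 2 * e <= normc d ->
  normc x <= e -> normc y <= e ->
  normc (((d + x)^-1 - d^-1 + x / d ^+ 2) - ((d + y)^-1 - d^-1 + y / d ^+ 2))
    * normc d ^+ 3 <= 10 * e * normc (x - y).
Proof.
move=> d0 ed xe ye.
have e0 : 0 <= e by exact: le_trans (normc_ge0 _) xe.
have dp : 0 < normc d by rewrite normc_gt0.
have half z : normc z <= e -> normc d / 2 <= normc (d + z).
  move=> ze; have := le_normcB (d + z) z; rewrite addrK; lra.
have dx := half _ xe; have dy := half _ ye.
have x0 : d + x != 0 by rewrite -normc_gt0; lra.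
have y0 : d + y != 0 by rewrite -normc_gt0; lra.
set G := _ - _ : C.
have GE : G * (d ^+ 2 * ((d + x) * (d + y))) = (x - y) * (d * (x + y) + x * y).
  by rewrite /G; field; rewrite d0 x0 y0.
have num : normc (d * (x + y) + x * y) <= 5 / 2 * normc d * e.
  apply: le_trans (le_normcD _ _) _; rewrite !Normc.normcM.
  have h1 : normc d * normc (x + y) <= normc d * (2 * e).
    rewrite ler_pM2l //; apply: le_trans (le_normcD _ _) _; lra.
  have h2 : normc x * normc y <= e * e by rewrite ler_pM ?normc_ge0.
  have h3 : 2 * e * e <= normc d * e by rewrite ler_wpM2r.
  lra.
have := congr1 normc GE; rewrite !Normc.normcM => NE.
have h1 : normc (x - y) * normc (d * (x + y) + x * y) <=
          normc (x - y) * (5 / 2 * normc d * e) by rewrite ler_wpM2l ?normc_ge0.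
have h2 : normc d / 2 * (normc d / 2) <= normc (d + x) * normc (d + y).
  by rewrite ler_pM // divr_ge0 // ltW.
have h3 : normc G * (normc d * normc d * (normc d / 2 * (normc d / 2))) <=
          normc (x - y) * (5 / 2 * normc d * e).
  apply: le_trans h1; rewrite -NE.
  by rewrite ler_wpM2l ?normc_ge0 // ler_wpM2l // mulr_ge0 // ltW.
rewrite -(ler_pM2l dp); lra.
Qed.

(** The velocity that the confinement gives to one vortex, up to the factor
    [i mu]. *)
Definition confine (z : C) : C := z / (1 - z * conjc z).

Lemma confine_den (z : C) : normc z <= 3 / 4 ->
  7 / 16 <= normc (1 - z * conjc z) /\ 1 - z * conjc z != 0.
Proof.
move=> z34; have zz : normc z ^+ 2 <= 9 / 16 by have := normc_ge0 z; nra.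
suff h : 7 / 16 <= normc (1 - z * conjc z) by split=> //; rewrite -normc_gt0; lra.
rewrite mulc_conj; have -> : 1 - (normc z ^+ 2)%:C%C = (1 - normc z ^+ 2)%:C%C.
  by rewrite rmorphB rmorph1.
by rewrite normc_real; apply: le_trans (ler_norm _); lra.
Qed.

Lemma confine_lip (z w : C) : normc z <= 3 / 4 -> normc w <= 3 / 4 ->
  normc (confine z - confine w) <= 9 * normc (z - w).
Proof.
move=> z34 w34; have [zd z0] := confine_den z34; have [wd w0] := confine_den w34.
set G := confine z - confine w.
have GE : G * ((1 - z * conjc z) * (1 - w * conjc w)) =
    (z - w) + z * w * conjc (z - w).
  by rewrite /G /confine conjcB; field; rewrite z0 w0.
have := congr1 normc GE; rewrite !Normc.normcM => NE.
have h1 : normc ((z - w) + z * w * conjc (z - w)) <= normc (z - w) * (25 / 16).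
  apply: le_trans (le_normcD _ _) _; rewrite !Normc.normcM normc_conj.
  have : normc z * normc w <= 3 / 4 * (3 / 4) by rewrite ler_pM ?normc_ge0.
  move=> /(ler_wpM2r (normc_ge0 (z - w))); lra.
have h2 : 7 / 16 * (7 / 16) <= normc (1 - z * conjc z) * normc (1 - w * conjc w).
  by rewrite ler_pM.
have := ler_wpM2l (normc_ge0 G) h2; rewrite NE; have := normc_ge0 (z - w); lra.
Qed.

(** The centre [1 / 2] stands for any point of the disc other than the origin. *)
Definition ring_curve (r : R) u s : C := (1 / 2)%:C%C + r%:C%C * (expi s * (1 + u s)).

(** All the terms of the equation of motion, multiplied by
    [- i r e^(-is) / lambda], that do not belong to its linear part; [kappa]
    is [mu / lambda], and the frame turns with angular velocity
    [2 b lambda / r]. *)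
Definition forcing (kappa r : R) u (b s : R) : C :=
  quad_inter m u s + (kappa * r)%:C%C * (mode (- 1) s * confine (ring_curve r u s))
  - (2 * r * b)%:C%C * (1 + u s).

Section Estimates.
Variables (kappa r rho d : R).
Hypotheses (kappa_gt0 : 0 < kappa) (r_gt0 : 0 < r) (r_le : r * 8 <= 1).
Hypotheses (rho_gt0 : 0 < rho) (rho_le1 : rho <= 1) (d_gt0 : 0 < d).
Hypothesis rho_d : 4 * rho <= d.
Hypothesis d_le : forall l, l != 0 -> d <= normc (1 - root l).

Lemma ring_curve_near u s : normc (u s) <= rho ->
  normc (ring_curve r u s - (1 / 2)%:C%C) <= 2 * r.
Proof.
move=> us; rewrite /ring_curve addrAC subrr add0r.
rewrite !Normc.normcM normc_real (gtr0_norm r_gt0) normc_expi mul1r mulrC ler_pM2r //.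
by apply: le_trans (le_normcD _ _) _; rewrite Normc.normc1; move: rho_le1; lra.
Qed.

Lemma ring_curve_le u s : normc (u s) <= rho -> normc (ring_curve r u s) <= 3 / 4.
Proof.
move=> us; have := ring_curve_near us => h.
rewrite -[ring_curve r u s](subrK (1 / 2)%:C%C); apply: le_trans (le_normcD _ _) _.
by rewrite normc_real ger0_norm; move: r_le; lra.
Qed.

Lemma gap_small u l s : (forall s, normc (u s) <= rho) -> l != 0 ->
  2 * (2 * rho) <= normc (1 - root l) /\ 1 - root l + gap u l s != 0.
Proof.
move=> ur l0; have := d_le l0; have := @gap_le _ _ u l _ ur s => h dl.
split; first (move: rho_d; lra).
rewrite -normc_gt0; have := le_normcB (1 - root l + gap u l s) (gap u l s).
by rewrite addrK; move: rho_d rho_gt0; lra.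
Qed.

Lemma forcing_lip u v (b b1 h : R) :
  (forall s, normc (u s) <= rho) -> (forall s, normc (v s) <= rho) ->
  `|b| <= rho -> `|b1| <= rho ->
  (forall s, normc (u s - v s) <= h) -> `|b - b1| <= h ->
  forall s, normc (forcing kappa r u b s - forcing kappa r v b1 s) <=
    (m.+1%:R * 40 / d ^+ 3 * rho + (9 * kappa + 6) * r) * h.
Proof.
move=> ur vr br b1r uv bb s.
have h0 : 0 <= h by exact: le_trans bb.
have -> : forcing kappa r u b s - forcing kappa r v b1 s =
  (quad_inter m u s - quad_inter m v s)
  + (kappa * r)%:C%C * (mode (- 1) s * (confine (ring_curve r u s) - confine (ring_curve r v s)))
  - (2 * r)%:C%C * ((b - b1)%:C%C * (1 + u s) + b1%:C%C * (u s - v s)).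
  rewrite /forcing !rmorphM rmorphB /=; ring.
apply: le_trans (le_normcB _ _) _.
have h1 : normc (quad_inter m u s - quad_inter m v s) <= m.+1%:R * 40 / d ^+ 3 * rho * h.
  rewrite /quad_inter -sumrB; apply: le_trans (normc_sum _ _ _) _.
  apply: le_trans (_ : \sum_(l : 'I_n | l != 0) (40 / d ^+ 3 * rho * h) <= _); last first.
    rewrite sumr_const card_ring -[leLHS]mulr_natl le_eqVlt; apply/orP; left; apply/eqP.
    by ring.
  apply: ler_sum => l l0.
  have [ed _] := gap_small s ur l0.
  have := quad_term_lip (root_neq1 R l0) ed (@gap_le _ _ u l _ ur s) (@gap_le _ _ v l _ vr s).
  set G := normc (_ - _) => hG.
  have d3 : 0 < d ^+ 3 by rewrite exprn_gt0.
  have dd : d ^+ 3 <= normc (1 - root l) ^+ 3.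
    by rewrite lerXn2r ?nnegrE ?normc_ge0 ?d_le // ltW.
  have G0 : 0 <= G by exact: normc_ge0.
  have -> : 40 / d ^+ 3 * rho * h = 40 * rho * h / d ^+ 3 by ring.
  rewrite ler_pdivlMr //.
  apply: le_trans (ler_wpM2l G0 dd) _; apply: le_trans hG _.
  have := @gap_lip _ _ u v l h uv s => /(ler_wpM2l (ltW rho_gt0)); lra.
have h2 : normc ((kappa * r)%:C%C * (mode (- 1) s *
   (confine (ring_curve r u s) - confine (ring_curve r v s)))) <= 9 * kappa * r * h.
  rewrite !Normc.normcM normc_real normc_mode mul1r ger0_norm ?mulr_ge0 ?(ltW kappa_gt0) ?(ltW r_gt0) //.
  have c1 := confine_lip (ring_curve_le (ur s)) (ring_curve_le (vr s)).
  have c2 : normc (ring_curve r u s - ring_curve r v s) <= h.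
    have -> : ring_curve r u s - ring_curve r v s = r%:C%C * (expi s * (u s - v s)).
      by rewrite /ring_curve; ring.
    rewrite !Normc.normcM normc_real normc_expi mul1r (gtr0_norm r_gt0).
    apply: le_trans (_ : 1 * h <= _); last by rewrite mul1r.
    by apply: ler_pM; rewrite ?normc_ge0 // ?(ltW r_gt0) //; move: r_le; lra.
  have c3 : normc (confine (ring_curve r u s) - confine (ring_curve r v s)) <= 9 * h by lra.
  have := ler_wpM2l (ltW (mulr_gt0 kappa_gt0 r_gt0)) c3; lra.
have h3 : normc ((2 * r)%:C%C * ((b - b1)%:C%C * (1 + u s) + b1%:C%C * (u s - v s))) <=
    6 * r * h.
  rewrite Normc.normcM normc_real ger0_norm ?mulr_ge0 ?(ltW r_gt0) //.
  have c : normc ((b - b1)%:C%C * (1 + u s) + b1%:C%C * (u s - v s)) <= 3 * h.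
    apply: le_trans (le_normcD _ _) _; rewrite !Normc.normcM !normc_real.
    have c1 : normc (1 + u s) <= 2.
      by apply: le_trans (le_normcD _ _) _; rewrite Normc.normc1; have := ur s; move: rho_le1; lra.
    have c2 : `|b - b1| * normc (1 + u s) <= h * 2 by rewrite ler_pM ?normc_ge0.
    have c3 : `|b1| * normc (u s - v s) <= 1 * h.
      by rewrite ler_pM ?normc_ge0 //; move: rho_le1; lra.
    lra.
  have := ler_wpM2l (ltW r_gt0) c; lra.
apply: le_trans (lerD (le_trans (le_normcD _ _) (lerD h1 h2)) h3) _.
lra.
Qed.

Lemma forcing0 s : normc (forcing kappa r (fun=> 0) 0 s) <= 2 * kappa * r.
Proof.
have -> : forcing kappa r (fun=> 0) 0 s =
    (kappa * r)%:C%C * (mode (- 1) s * confine (ring_curve r (fun=> 0) s)).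
  rewrite /forcing mulr0 mul0r subr0 /quad_inter big1 ?add0r // => l l0.
  by rewrite /gap conjc0 mulr0 subr0 addr0 subrr mul0r addr0.
rewrite 2!Normc.normcM normc_real normc_mode mul1r ger0_norm ?mulr_ge0 ?(ltW kappa_gt0) ?(ltW r_gt0) //.
have q34 : normc (ring_curve r (fun=> 0) s) <= 3 / 4.
  by apply: ring_curve_le; rewrite Normc.normc0 ltW.
have [dq _] := confine_den q34.
have c : normc (confine (ring_curve r (fun=> 0) s)) <= 2.
  rewrite /confine Normc.normcM Normc.normcV ler_pdivrMr; lra.
have := ler_wpM2l (ltW (mulr_gt0 kappa_gt0 r_gt0)) c; lra.
Qed.

(** Reversibility comes from the reflection of the ring, which exchanges the
    terms of indices [l] and [- l] of the interaction. *)
Lemma forcing_approx u b : trigpoly u -> reversible u ->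
  (forall s, normc (u s) <= rho) -> `|b| <= rho ->
  approximable (forcing kappa r u b) /\ reversible (forcing kappa r u b).
Proof.
move=> tu ru ur br.
have tq : trigpoly (ring_curve r u).
  apply: trigpolyD; first exact: trigpoly_cst.
  apply: trigpolyZ; apply: trigpolyM.
    exact: trigpoly_expi.
  by apply: trigpolyD => //; exact: trigpoly_cst.
have pu := trigpoly_periodic tu.
have rq : reversible (ring_curve r u).
  by move=> s; rewrite /ring_curve conjcD conjcR !conjcM conjcR conjcD conjc1 expiN ru.
split.
- have -> : forcing kappa r u b = fun s =>
    (quad_inter m u s + (kappa * r)%:C%C * (mode (- 1) s * confine (ring_curve r u s)))
    + (- (2 * r * b)%:C%C) * (1 + u s) by apply/funext => s; rewrite mulNr.
  apply: approxD; last first.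
    by apply/approx_trigpoly/trigpolyZ/trigpolyD => //; exact: trigpoly_cst.
  apply: approxD.
    apply: approx_sum => l l0; apply: approxD.
      apply: approxD; last exact: approx_cst.
      apply: (@approx_inv _ _ _ (2 * rho)).
      - exact/approx_trigpoly/gap_trigpoly.
      - exact: root_neq1.
      - by have [+ _] := gap_small 0 ur l0; move: rho_gt0; lra.
      - exact: gap_le.
    apply: approxM; last exact: approx_cst.
    exact/approx_trigpoly/gap_trigpoly.
  apply/approxZ/approxM; first exact/approx_trigpoly/trigpoly_mode.
  apply: approxM; first exact: approx_trigpoly.
  apply: (@approx_inv1B _ _ (9 / 16)); last 2 first.
  - lra.
  - move=> s; rewrite Normc.normcM normc_conj.
    have := ring_curve_le (ur s); have := normc_ge0 (ring_curve r u s); nra.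
  exact/approx_trigpoly/trigpolyM/trigpoly_conj.
- move=> s; rewrite /forcing.
  have cf (x y z w : C) (p q : R) : conjc (x + p%:C%C * (y * z) - q%:C%C * (1 + w)) =
      conjc x + p%:C%C * (conjc y * conjc z) - q%:C%C * (1 + conjc w).
    by rewrite conjcB conjcD !conjcM !conjcR conjcD conjc1.
  rewrite cf mode_oppr ru.
  congr (_ + _ * (_ * _) - _).
    rewrite /quad_inter conjc_sum -sum_ringN; apply: eq_bigr => l l0.
    have cq (x y : C) : conjc ((x + y)^-1 - x^-1 + y / x ^+ 2) =
        (conjc x + conjc y)^-1 - (conjc x)^-1 + conjc y / conjc x ^+ 2.
      by rewrite !(rmorphD, rmorphN, rmorphM, fmorphV, rmorphXn).
    by rewrite cq gap_reversible // rootN [conjc (1 - _)]conjcB conjc1.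
  have cc (z : C) : conjc (z / (1 - z * conjc z)) = conjc z / (1 - conjc z * z).
    by rewrite conjcM conjc_inv conjcB conjc1 conjcM conjcK.
  by rewrite /confine rq cc conjcK.
Qed.

End Estimates.
End RingCurve.

(** * The ring curve solves the equation of motion *)

Section RingSolution.
Variables (R : realType) (m : nat).
Local Notation C := R[i].
Local Notation normc := (@Normc.normc R).
Local Notation n := m.+2.
Implicit Types (s t : R) (l : 'I_n) (u v : R -> C).

Local Notation a := (ring_speed R m).
Local Notation lin := (linop a (lin_inter m)).

Lemma cderiv_realpoly N (c : int -> R) : cderiv (realpoly N c)
  (fun s => \sum_(k <- zrange N) (c k)%:C%C * ((k%:~R)%:C%C * 'i%C * mode k s)).
Proof. by apply: cderiv_sum => k; exact/cderivZ/cderiv_mode. Qed.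

Lemma linop_solve : exists2 K : R, 0 < K & forall N c (M : R), 0 < M ->
  (forall s, normc (realpoly N c s) <= M) ->
  exists v v' b, [/\ trigpoly v, reversible v, cderiv v v',
    lin v v' b =1 realpoly N c & (forall s, normc (v s) <= K * M) /\ `|b| <= K * M].
Proof.
have [K K0 HK] := linear_solve (ring_speed_gt0 R m) (couplingN R m)
  (coupling1 R m) (coupling0 R m) (@coupling_le R m).
exists K => // N c M M0 cM; have [u [b [ub uM bM]]] := HK N c M M0 cM.
exists (realpoly N u); eexists; exists b; split.
- exact: trigpoly_realpoly.
- exact: reversible_realpoly.
- exact: cderiv_realpoly.
- move=> s; rewrite -ub /linop lin_inter_realpoly; congr (_ + _).
  rewrite /realpoly mulr_sumr -sumrB mulr_sumr -sumrB; apply: eq_bigr => k _.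
  have ii : 'i%C * 'i%C = -1 :> C by rewrite -expr2 sqr_i.
  move: (ring_speed R m) => A.
  rewrite rmorphB !rmorphM rmorphD rmorph1 /=.
  rewrite mulrBl; congr (_ - _).
  transitivity (A%:C%C * ((u k)%:C%C * mode k s
     - 'i%C * 'i%C * (k%:~R)%:C%C * (u k)%:C%C * mode k s)); first by ring.
  by rewrite ii; ring.
- by split.
Qed.

Lemma mul_le1_of_le_inv (x D y : R) : 0 <= x -> x <= D -> 0 < D -> y <= D^-1 -> x * y <= 1.
Proof.
move=> x0 xD D0 yD; apply: le_trans (_ : D * D^-1 <= _); last by rewrite divff // gt_eqF.
apply: le_trans (ler_wpM2l x0 yD) _.
by rewrite ler_wpM2r // invr_ge0 ltW.
Qed.

(** The equation for the relative displacement [u] and the one for the curve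
    differ by the factor [i lambda e^(is) / r].  Here [e] stands for [e^(is)],
    [M] for its inverse, [X] and [Y] for the two parts of the interaction and
    [F] for the confinement. *)
Lemma rescale_equation (A B L K r e M u v X Y F : C) :
  r != 0 -> e * M = 1 ->
  A * (u - 'i%C * v) - X + B * M = Y + K * r * (M * F) - 2 * r * B * (1 + u) ->
  L * A / r ^+ 2 * (r * (e * ('i%C * (1 + u) + v)))
    + 'i%C * (2 * B * L / r * (1 / 2 + r * (e * (1 + u)))) =
  'i%C * (L * K * F + L * (e / r * (A + X + Y))).
Proof.
move=> r0 eM h; have ii : 'i%C * 'i%C = -1 :> C by rewrite -expr2 sqr_i.
have -> : Y = A * (u - 'i%C * v) - X + B * M - K * r * (M * F) + 2 * r * B * (1 + u).
  by rewrite h; ring.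
transitivity ('i%C * L * A * e / r * (1 + u) - ('i%C * 'i%C) * L * A * e / r * v
   + 'i%C * L * B / r + 'i%C * 2 * B * L * e * (1 + u)).
  by rewrite ii; field; rewrite r0.
transitivity ('i%C * L * A * e / r * (1 + u) - ('i%C * 'i%C) * L * A * e / r * v
   + 'i%C * L * B / r * (e * M) + 'i%C * 2 * B * L * e * (1 + u)
   + 'i%C * L * K * F * (1 - e * M)).
  by rewrite eM; ring.
by field; rewrite r0.
Qed.

(** For every small radius [r] there is a curve [q], turning once around the
    fixed point [1 / 2] of the rotating frame, such that the points
    [q (s - angle l)] chase each other along it. *)
Lemma ring_curve_exists (mu lambda : R) : 0 < mu -> 0 < lambda ->
  exists2 r0 : R, 0 < r0 & forall r : R, 0 < r -> r <= r0 ->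
  exists (q q' : R -> C) (w Om : R),
  [/\ cderiv q q' /\ turn_periodic q, 0 < w,
    forall s, normc (q s - (1 / 2)%:C%C) <= 2 * r,
    forall s l, l != 0 -> 0 < normc (q s - q (s - angle l)) <= 4 * r &
    forall s, w%:C%C * q' s + 'i%C * (Om%:C%C * q s) =
      'i%C * (mu%:C%C * confine (q s) + lambda%:C%C *
        \sum_(l : 'I_n | l != 0) (conjc (q s - q (s - angle l)))^-1)].
Proof.
move=> mu0 la0.
have [kappa ka0 lk] : exists2 kappa, 0 < kappa & lambda * kappa = mu.
  by exists (mu / lambda); rewrite ?divr_gt0 // mulrC divfK // gt_eqF.
have [d d0 dP] := root_gap R m.
have [K K0 HK] := linop_solve.
pose Q : R := m.+1%:R * 40 / d ^+ 3.
have Q0 : 0 <= Q by rewrite divr_ge0 ?mulr_ge0 ?exprn_ge0 // ltW.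
(* The displacement must stay below [1], below a quarter of the least chord
   and below what makes the quadratic part a contraction: [E] adds up the
   inverses of these bounds. *)
pose E : R := 1 + 4 / d + 10 * (K * Q).
have KQ0 : 0 <= K * Q by rewrite mulr_ge0 // ltW.
have fd0 : 0 < 4 / d by rewrite divr_gt0.
have E0 : 0 < E by rewrite /E; lra.
pose rho := E^-1.
have rho0 : 0 < rho by rewrite invr_gt0.
have rho1 : rho <= 1 by have := @mul_le1_of_le_inv 1 E rho ler01 ltac:(rewrite /E; lra) E0 (lexx _); lra.
have rhod : 4 * rho <= d.
  have := @mul_le1_of_le_inv (4 / d) E rho (ltW fd0) ltac:(rewrite /E; lra) E0 (lexx _).
  by rewrite mulrAC ler_pdivrMr // mul1r.
have rhoQ : 10 * (K * Q) * rho <= 1.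
  by apply: (@mul_le1_of_le_inv _ E) => //; rewrite /E; lra.
pose kr := 5 * (K * kappa) / rho.
have Kk0 : 0 < K * kappa by exact: mulr_gt0.
have kr0 : 0 <= kr by rewrite divr_ge0 ?ltW // mulr_gt0.
(* Likewise the radius must keep the ring in the disc of radius [3 / 4], make
   the confining terms a contraction and make the first residual small compared
   with [rho]. *)
pose E1 : R := 8 + 10 * K * (9 * kappa + 6) + kr.
have t0 : 0 <= 10 * K * (9 * kappa + 6) by apply: mulr_ge0; [rewrite mulr_ge0 // ltW|lra].
have E10 : 0 < E1 by rewrite /E1; lra.
exists E1^-1 => [|r r0 rE]; first by rewrite invr_gt0.
have r8 : r * 8 <= 1.
  by rewrite mulrC; apply: (@mul_le1_of_le_inv _ E1) => //; rewrite /E1; lra.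
have rK : 10 * K * (9 * kappa + 6) * r <= 1.
  by apply: (@mul_le1_of_le_inv _ E1) => //; rewrite /E1; lra.
have rkr : kr * r <= 1.
  by apply: (@mul_le1_of_le_inv _ E1) => //; rewrite /E1; lra.
have eta0 : 0 < 2 * kappa * r by rewrite !mulr_gt0.
have Keta : K * (2 * kappa * r) * 5 <= rho * 2.
  by move: rkr; rewrite /kr mulrAC ler_pdivrMr //; lra.
have Kkap : K * (Q * rho + (9 * kappa + 6) * r) * 5 <= 1 by lra.
have L0 : 0 <= \sum_(l : 'I_n | l != 0) 2 / chord2 l :> R.
  by apply: sumr_ge0 => l l0; rewrite divr_ge0 // ltW ?chord2_gt0.
have [u [v [b [dv pu u_le b_le eqn]]]] := @weakly_nonlinear_solution _ _ _ _ (ring_speed_gt0 R m) L0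
  (@lin_interD R m) (@lin_inter_lip R m) K HK (forcing m kappa r) rho _ _
  rho0 eta0 Keta Kkap (forcing0 m ka0 r0 r8 rho0 rho1)
  (forcing_lip ka0 r0 r8 rho0 rho1 d0 rhod dP)
  (@forcing_approx _ _ kappa _ _ _ r0 r8 rho0 rho1 rhod dP).
have rC : r%:C%C != 0 :> C by rewrite -normc_eq0 normc_real normr_eq0 gt_eqF.
have laC : lambda%:C%C != 0 :> C by rewrite -normc_eq0 normc_real normr_eq0 gt_eqF.
have qdiff s l : ring_curve r u s - ring_curve r u (s - angle l) =
    r%:C%C * (expi s * conjc (1 - root l + gap u l s)).
  rewrite /ring_curve /gap conjcD !conjcB conjcM !conjcK conjc1 expiD expiN.
  rewrite -/(root l); ring.
exists (ring_curve r u), (fun s => r%:C%C * (expi s * ('i%C * (1 + u s) + v s))),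
  (lambda * a / r ^+ 2), (2 * b * lambda / r); split.
- split; last first.
    by move=> s; rewrite /ring_curve expi_periodic pu.
  apply: cderiv_eq (cderivD (cderiv_cst (1 / 2)%:C%C) (cderivZ r%:C%C
    (cderivM (@cderiv_expi R) (cderivD (cderiv_cst 1) dv)))) _ _ => s //.
  by rewrite add0r add0r; ring.
- by rewrite divr_gt0 ?mulr_gt0 ?exprn_gt0 ?ring_speed_gt0.
- by move=> s; exact (ring_curve_near r0 rho1 (u_le s)).
- move=> s l l0; rewrite qdiff !Normc.normcM normc_real normc_expi mul1r normc_conj.
  rewrite (gtr0_norm r0) mulr_gt0 //=; last first.
    by rewrite normc_gt0; have [] := gap_small rho0 rhod dP s u_le l0.
  rewrite mulrC ler_pM2r //; apply: le_trans (le_normcD _ _) _.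
  have h1 : normc (1 - root l) <= 2.
    by apply: le_trans (le_normcB _ _) _; rewrite normc_root Normc.normc1; lra.
  have := gap_le l u_le s; lra.
- move=> s; have := eqn s; rewrite /linop /forcing => h.
  have e1 : expi s * mode (- 1) s = 1 by rewrite modeN mode1 mulc_conj normc_expi expr1n.
  have -> : \sum_(l : 'I_n | l != 0) (conjc (ring_curve r u s - ring_curve r u (s - angle l)))^-1 =
      expi s / r%:C%C * (a%:C%C + lin_inter m u s + quad_inter m u s).
    rewrite -interE mulr_sumr; apply: eq_bigr => l l0; rewrite qdiff.
    rewrite !conjcM conjcR conjcK; set X := 1 - root l + _.
    have es : conjc (expi s) = (expi s)^-1.
      by apply: (mulfI (expi_neq0 s)); rewrite divff ?expi_neq0 // mulc_conj normc_expi expr1n.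
    by rewrite es !invfM invrK; ring.
  have two : (2 : R)%:C%C = 2 :> C by exact: rmorph_nat.
  have half : (1 / 2 : R)%:C%C = 1 / 2 :> C by rewrite -two rmorphM rmorph1 fmorphV.
  have push2 (x y z : R) : (x * y / z ^+ 2)%:C%C = x%:C%C * y%:C%C / z%:C%C ^+ 2 :> C.
    by rewrite rmorphM fmorphV rmorphXn rmorphM.
  have push1 (x y z : R) : (2 * x * y / z)%:C%C = 2 * x%:C%C * y%:C%C / z%:C%C :> C.
    by rewrite -two !rmorphM fmorphV.
  have push0 (x y : R) : (2 * x * y)%:C%C = 2 * x%:C%C * y%:C%C :> C.
    by rewrite -two !rmorphM.
  have kr1 : (kappa * r)%:C%C = kappa%:C%C * r%:C%C :> C by exact: rmorphM.
  have mu1 : mu%:C%C = lambda%:C%C * kappa%:C%C :> C by rewrite -lk; exact: rmorphM.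
  move: h; rewrite mu1 push0 kr1 => /(rescale_equation lambda%:C%C rC e1) <-.
  by rewrite push1 push2 /ring_curve half.
Qed.

End RingSolution.

(** * The Hamiltonian vector field in complex coordinates *)

Section Dynamics.
Variables (R : realType) (n : nat).
Local Notation C := R[i].
Local Notation normc := (@Normc.normc R).
Local Notation Re := (@complex.Re R).
Local Notation Im := (@complex.Im R).
Implicit Types (Z V : config R n) (i j : 'I_n) (k : 'I_2).

Definition vortex Z i : C := Complex (Z i 0) (Z i 1).

Lemma ord2P k : k = 0 \/ k = 1.
Proof. by case: k => -[|[|k]] // p; [left|right]; exact: val_inj. Qed.

Lemma sqnorm_row Z i : sqnorm (row i Z) = normc (vortex Z i) ^+ 2.
Proof. by rewrite sqr_normcE /sqnorm !mxE. Qed.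

Lemma sqnorm_rowB Z i j :
  sqnorm (row i Z - row j Z) = normc (vortex Z i - vortex Z j) ^+ 2.
Proof. by rewrite sqr_normcE /sqnorm !mxE. Qed.

Lemma is_derive_bigsum (I : Type) (r : seq I) (P : pred I) (F : I -> R -> R)
    (F' : I -> R) (s : R) : (forall x, P x -> is_derive s (1 : R) (F x) (F' x)) ->
  is_derive s (1 : R) (fun t => \sum_(x <- r | P x) F x t) (\sum_(x <- r | P x) F' x).
Proof.
move=> dF; elim: r => [|x r IH].
  rewrite big_nil; under eq_fun do rewrite big_nil.
  exact: is_derive_cst.
rewrite big_cons; case Px: (P x); under eq_fun do rewrite big_cons Px; last exact: IH.
exact: (@is_deriveD _ _ _ _ _ _ _ _ _ (dF x Px) IH).
Qed.

Lemma derive_along (f : config R n -> R) Z V (d : R) :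
  is_derive (0 : R) (1 : R) (fun h : R => f (h *: V + Z)) d -> 'D_V f Z = d.
Proof.
move=> [_ <-]; rewrite /derive; apply: (congr1 (fun F : R -> R => lim (F @ 0^'))).
apply/funext => h /=.
by rewrite addr0 scale0r add0r /GRing.scale /= mulr1.
Qed.

(** Both sides vanish for [x <= 0]. *)
Lemma ln_inv (x : R) : ln (1 / x) = - ln x.
Proof.
rewrite div1r; have [x0|x0] := ltP 0 x; first by rewrite lnV ?posrE.
by rewrite !ln0 ?oppr0 // invr_le0.
Qed.

Lemma sqnorm_eq0 (z : 'rV[R]_2) : sqnorm z = 0 -> z = 0.
Proof.
move=> /eqP; rewrite paddr_eq0 ?sqr_ge0 // !sqrf_eq0 => /andP[/eqP z0 /eqP z1].
by apply/rowP => k; rewrite !mxE; have [->|->] := ord2P k.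
Qed.

Lemma sqnorm_gt0 (z : 'rV[R]_2) : z != 0 -> 0 < sqnorm z.
Proof.
move=> z0; rewrite lt_neqAle addr_ge0 ?sqr_ge0 // andbT eq_sym.
by apply: contra z0 => /eqP/sqnorm_eq0 ->.
Qed.

(** Only the pairs containing [i] contribute, and by antisymmetry those in which
    [i] comes second count as if it came first. *)
Lemma sum_pairs_antisym i (A : 'I_n -> 'I_n -> R) :
  (forall j l, A l j = - A j l) ->
  \sum_(j < n) \sum_(l < n | (j < l)%N) ((j == i)%:R - (l == i)%:R) * A j l =
  \sum_(j < n | j != i) A i j.
Proof.
move=> anti.
under eq_bigr do under eq_bigr do rewrite mulrBl.
under eq_bigr do rewrite sumrB.
have -> : \sum_(j < n) (\sum_(l < n | (j < l)%N) (j == i)%:R * A j l -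
      \sum_(l < n | (j < l)%N) (l == i)%:R * A j l) =
    \sum_(l < n | (i < l)%N) A i l - \sum_(j < n | (j < i)%N) A j i.
  rewrite sumrB; congr (_ - _).
    rewrite (bigD1 i) //= [X in _ + X]big1 => [|j /negbTE ji]; last first.
      by apply: big1 => l _; rewrite ji mul0r.
    by rewrite addr0; apply: eq_bigr => l _; rewrite eqxx mul1r.
  rewrite (exchange_big_dep xpredT) //= (bigD1 i) //= [X in _ + X]big1 => [|l /negbTE li]; last first.
    by apply: big1 => j _; rewrite li mul0r.
  by rewrite addr0; apply: eq_bigr => j _; rewrite eqxx mul1r.
rewrite -sumrN [RHS](bigID (fun j : 'I_n => (i < j)%N)) /=; congr (_ + _).
  apply: eq_bigl => j.
  by apply/idP/andP => [ij|[]//]; split=> //; apply: contraTneq ij => ->; rewrite ltnn.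
apply: eq_big => [j|j _]; last by rewrite -anti.
by rewrite -leqNgt ltn_neqAle.
Qed.

Definition energy_force (mu lambda : R) Z i k : R :=
  mu * (Z i k / (1 - sqnorm (row i Z))) +
  lambda * \sum_(j | j != i) (Z i k - Z j k) / sqnorm (row i Z - row j Z).

Lemma is_derive_affine (x y s : R) : is_derive s (1 : R) (fun h : R => h * x + y) x.
Proof.
rewrite (_ : (fun h => _) = x *: (id : R -> R) + cst y); last first.
  by apply/funext => h; rewrite /GRing.scale /GRing.add /= mulrC.
by apply: is_derive_eq; rewrite addr0 /GRing.scale /= mulr1.
Qed.

Lemma is_derive_sqr_affine (x y x1 y1 : R) :
  is_derive (0 : R) (1 : R) (fun h : R => (h * x + y) ^+ 2 + (h * x1 + y1) ^+ 2)
    (2 * (x * y + x1 * y1)).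
Proof.
have h1 := is_derive_affine x y 0; have h2 := is_derive_affine x1 y1 0.
rewrite (_ : (fun h => _) = (fun h => (h * x + y)) * (fun h => (h * x + y))
  + (fun h => (h * x1 + y1)) * (fun h => (h * x1 + y1))); last first.
  by apply/funext => h; rewrite !expr2.
apply: is_derive_eq (@is_deriveD _ _ _ _ _ _ _ _ _ (@is_deriveM _ _ _ _ _ _ _ _ h1 h1)
  (@is_deriveM _ _ _ _ _ _ _ _ h2 h2)) _.
by rewrite /GRing.scale /= !mul0r !add0r; ring.
Qed.

Lemma gradient_hamiltonian (mu lambda : R) Z : (polydisc (R:=R) (n:=n) `\` @collisions R n) Z ->
  gradient (hamiltonian mu lambda) Z = \matrix_(i, k) - energy_force mu lambda Z i k.
Proof.
move=> [Zd Zc]; apply/matrixP => i k; rewrite !mxE; apply: derive_along.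
set V := delta_mx i k.
have rowE j (h : R) l : row j (h *: V + Z) 0 l = h * V j l + Z j l by rewrite !mxE.
have rowBE j1 j2 (h : R) l : (row j1 (h *: V + Z) - row j2 (h *: V + Z)) 0 l =
    h * (V j1 l - V j2 l) + (Z j1 l - Z j2 l) by rewrite !mxE; ring.
have d1 j : is_derive (0 : R) (1 : R) (fun h => ln (1 / (1 - sqnorm (row j (h *: V + Z)))))
    (2 * (V j 0 * Z j 0 + V j 1 * Z j 1) / (1 - sqnorm (row j Z))).
  under eq_fun do rewrite ln_inv /sqnorm !rowE.
  have p : 0 < 1 - sqnorm (row j Z) by rewrite subr_gt0; exact: Zd.
  have ds := is_derive_sqr_affine (V j 0) (Z j 0) (V j 1) (Z j 1).
  have p' : 0 < 1 - ((0 * V j 0 + Z j 0) ^+ 2 + (0 * V j 1 + Z j 1) ^+ 2).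
    by rewrite !mul0r !add0r; move: p; rewrite /sqnorm !mxE.
  have d2 : is_derive (0 : R) (1 : R) (fun h : R => 1 - ((h * V j 0 + Z j 0) ^+ 2 + (h * V j 1 + Z j 1) ^+ 2))
     (- (2 * (V j 0 * Z j 0 + V j 1 * Z j 1))).
    rewrite -[- _]add0r; exact: is_deriveB.
  have d3 := @is_derive1_ln R _ p'.
  have d4 := @is_derive1_comp R (@ln R) (fun h : R => 1 - ((h * V j 0 + Z j 0) ^+ 2 + (h * V j 1 + Z j 1) ^+ 2)) 0 _ _ d3 d2.
  have d5 := @is_deriveN _ _ _ _ _ _ _ d4.
  apply: is_derive_eq d5 _.
  rewrite !mul0r !add0r /sqnorm !mxE; field.
  by move: p; rewrite /sqnorm !mxE => p; rewrite gt_eqF.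
have d2 j1 j2 : (j1 < j2)%N -> is_derive (0 : R) (1 : R)
    (fun h => ln (sqnorm (row j1 (h *: V + Z) - row j2 (h *: V + Z))))
    (2 * ((V j1 0 - V j2 0) * (Z j1 0 - Z j2 0) + (V j1 1 - V j2 1) * (Z j1 1 - Z j2 1))
      / sqnorm (row j1 Z - row j2 Z)).
  move=> jj.
  under eq_fun do rewrite /sqnorm !rowBE.
  have p : 0 < sqnorm (row j1 Z - row j2 Z).
    apply: sqnorm_gt0; rewrite subr_eq0; apply/eqP => e.
    by apply: Zc; exists j1, j2.
  have p' : 0 < (0 * (V j1 0 - V j2 0) + (Z j1 0 - Z j2 0)) ^+ 2
              + (0 * (V j1 1 - V j2 1) + (Z j1 1 - Z j2 1)) ^+ 2.
    by rewrite !mul0r !add0r; move: p; rewrite /sqnorm !mxE.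
  have ds := is_derive_sqr_affine (V j1 0 - V j2 0) (Z j1 0 - Z j2 0)
    (V j1 1 - V j2 1) (Z j1 1 - Z j2 1).
  have d3 := @is_derive1_ln R _ p'.
  have d4 := @is_derive1_comp R (@ln R) _ 0 _ _ d3 ds.
  apply: is_derive_eq d4 _.
  by rewrite !mul0r !add0r /sqnorm !mxE mulrC.
have dA := is_derive_bigsum (index_enum 'I_n) (fun j (_ : xpredT j) => d1 j).
have dB := is_derive_bigsum (index_enum 'I_n) (fun j1 (_ : xpredT j1) =>
  is_derive_bigsum (index_enum 'I_n) (fun j2 (jj : (j1 < j2)%N) => d2 j1 j2 jj)).
have dAB := @is_deriveZ _ _ _ _ (- (1 / 2)) _ _ _
  (@is_deriveD _ _ _ _ _ _ _ _ _ (@is_deriveZ _ _ _ _ mu _ _ _ dA) (@is_deriveZ _ _ _ _ lambda _ _ _ dB)).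
apply: is_derive_eq dAB _.
rewrite /GRing.scale /= /energy_force.
have VE j (f : 'I_2 -> R) : V j 0 * f 0 + V j 1 * f 1 = (j == i)%:R * f k.
  rewrite !mxE; case: eqP => _; last by rewrite !mul0r addr0.
  by have [->|->] := ord2P k; rewrite /= !(mul0r, mul1r, add0r, addr0).
have -> : \sum_(j < n) 2 * (V j 0 * Z j 0 + V j 1 * Z j 1) / (1 - sqnorm (row j Z)) =
    2 * (Z i k / (1 - sqnorm (row i Z))).
  under eq_bigr do rewrite (VE _ (Z _)).
  rewrite (bigD1 i) //= eqxx mul1r big1 ?addr0 -?mulrA // => j /negbTE ->.
  by rewrite mul0r mulr0 mul0r.
have -> : \sum_(j1 < n) \sum_(j2 < n | (j1 < j2)%N)
    2 * ((V j1 0 - V j2 0) * (Z j1 0 - Z j2 0) + (V j1 1 - V j2 1) * (Z j1 1 - Z j2 1))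
      / sqnorm (row j1 Z - row j2 Z) =
    2 * \sum_(j | j != i) (Z i k - Z j k) / sqnorm (row i Z - row j Z).
  rewrite -(@sum_pairs_antisym i (fun j1 j2 => (Z j1 k - Z j2 k) / sqnorm (row j1 Z - row j2 Z))).
    rewrite mulr_sumr; apply: eq_bigr => j1 _; rewrite mulr_sumr; apply: eq_bigr => j2 _.
    have := VE j1 (fun l => Z j1 l - Z j2 l); have := VE j2 (fun l => Z j1 l - Z j2 l).
    set s := _^-1; move=> h1 h2.
    rewrite !mulrBl addrACA -opprD h1 h2; ring.
  move=> j l; rewrite -opprB mulNr; congr (- (_ / _)).
  by rewrite !sqnorm_rowB normc_distC.
by move: (Z i k / _) (\sum_(j | _) _) => x y; field.
Qed.

Definition config_of (z : 'I_n -> C) : config R n :=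
  \matrix_(i, k) if k == 0 then Re (z i) else Im (z i).

Lemma config_ofK z i : vortex (config_of z) i = z i.
Proof. by rewrite /vortex !mxE /=; case: (z i). Qed.

(** The velocity of a vortex is [i] times this. *)
Definition force (mu lambda : R) (z : 'I_n -> C) i : C :=
  mu%:C%C * confine (z i) + lambda%:C%C * \sum_(j | j != i) (conjc (z i - z j))^-1.

Lemma forceE (mu lambda : R) z i : force mu lambda z i =
  Complex (energy_force mu lambda (config_of z) i 0)
          (energy_force mu lambda (config_of z) i 1).
Proof.
have conjV (x : C) : (conjc x)^-1 = ((normc x ^+ 2)^-1)%:C%C * x.
  have [->|x0] := eqVneq x 0; first by rewrite conjc0 invr0 mulr0.
  have cx0 : conjc x != 0 by rewrite conjc_eq0.
  have nx : (normc x ^+ 2)%:C%C != 0 :> C by rewrite -mulc_conj mulf_neq0.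
  apply: (mulfI nx); rewrite mulrA fmorphV divff // mul1r -mulc_conj mulfK //.
have confE (x : C) : confine x = ((1 - normc x ^+ 2)^-1)%:C%C * x.
  rewrite /confine mulc_conj mulrC; congr (_ * _).
  by rewrite fmorphV rmorphB rmorph1.
rewrite /force /energy_force; apply: eq_ReIm; rewrite ?Re_add ?Im_add ?Re_scale ?Im_scale ?Re_sum ?Im_sum.
- congr (_ * _ + _ * _); first by rewrite confE Re_scale sqnorm_row config_ofK !mxE mulrC.
  apply: eq_bigr => j _; rewrite conjV Re_scale sqnorm_rowB !config_ofK !mxE mulrC.
  by rewrite /=; case: (z i) (z j) => [? ?] [? ?].
- congr (_ * _ + _ * _); first by rewrite confE Im_scale sqnorm_row config_ofK !mxE mulrC.
  apply: eq_bigr => j _; rewrite conjV Im_scale sqnorm_rowB !config_ofK !mxE mulrC.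
  by rewrite /=; case: (z i) (z j) => [? ?] [? ?].
Qed.

Section Solution.
Variables (mu lambda : R) (z z' : 'I_n -> R -> C).
Hypothesis z_deriv : forall i, cderiv (z i) (z' i).
Hypothesis z_disc : forall i t, normc (z i t) < 1.
Hypothesis z_inj : forall i j t, i != j -> z i t != z j t.
Hypothesis z_eqn : forall i t, z' i t = 'i%C * force mu lambda (z^~ t) i.

Let Z t := config_of (z^~ t).

Lemma complex_solution : is_solution mu lambda Z.
Proof.
move=> t.
have dom : (polydisc (R:=R) (n:=n) `\` @collisions R n) (Z t).
  split=> [i|[i [j [ij e]]]].
    rewrite sqnorm_row config_ofK; have := z_disc i t; have := normc_ge0 (z i t); nra.
  have ne : i != j by rewrite neq_ltn ij.
  have /eqP := z_inj t ne; apply.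
  rewrite -(config_ofK (z^~ t) i) -(config_ofK (z^~ t) j) /vortex.
  have ek k : Z t i k = Z t j k by move/rowP: e => /(_ k); rewrite !mxE.
  by have := ek 0; have := ek 1; rewrite /Z => -> ->.
split=> //; rewrite gradient_hamiltonian //.
have ent i k : is_derive t (1 : R) (fun s => Z s i k)
    (if k == 0 then Re (z' i t) else Im (z' i t)).
  have [dr di] := z_deriv i t.
  rewrite (_ : (fun s => _) = (fun s => if k == 0 then Re (z i s) else Im (z i s)));
    last by apply/funext => s; rewrite mxE.
  by case: eqP.
have dZ : derivable Z t 1 by apply/derivable_mxP => i k; have [] := ent i k.
split=> //; rewrite derive_mx //; apply/matrixP => i k; rewrite mxE.
have [_ ->] := ent i k; rewrite z_eqn forceE /J2n mxE !big_ord_recl big_ord0 /J2 !mxE.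
have o1 : lift ord0 ord0 = 1 :> 'I_2 by exact: val_inj.
by have [->|->] := ord2P k; rewrite /= ?mxE /= o1 -/(Z t); ring.
Qed.

(** The confining forces are radial, and exchanging the two indices of the
    interaction turns [S] into the number of pairs minus [S], so [S] is real. *)
Lemma inertia_constant s t : inertia (Z s) = inertia (Z t).
Proof.
apply: (@is_derive_0_is_cst R (fun t => inertia (Z t))) => {s}t.
rewrite (_ : (fun t => _) = (fun t => \sum_(i < n) ((Re (z i t)) ^+ 2 + (Im (z i t)) ^+ 2))); last first.
  by apply/funext => s; apply: eq_bigr => i _; rewrite sqnorm_row config_ofK sqr_normcE.
have d i : is_derive t (1 : R) (fun t => (Re (z i t)) ^+ 2 + (Im (z i t)) ^+ 2)
    (2 * Re (conjc (z i t) * z' i t)).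
  have [dr di] := z_deriv i t.
  rewrite (_ : (fun t => _) = (fun t => Re (z i t)) * (fun t => Re (z i t))
      + (fun t => Im (z i t)) * (fun t => Im (z i t))); last first.
    by apply/funext => s; rewrite !expr2.
  apply: is_derive_eq (@is_deriveD _ _ _ _ _ _ _ _ _ (@is_deriveM _ _ _ _ _ _ _ _ dr dr)
    (@is_deriveM _ _ _ _ _ _ _ _ di di)) _.
  rewrite Re_mul /GRing.scale /=.
  by case: (z i t) => x y /=; ring.
apply: is_derive_eq (is_derive_bigsum (index_enum 'I_n) (fun i (_ : xpredT i) => d i)) _.
rewrite -mulr_sumr -Re_sum.
under eq_bigr do rewrite z_eqn.
pose S := \sum_(i < n) \sum_(j | j != i) conjc (z i t) * (conjc (z i t - z j t))^-1.
have SE : S + S = \sum_(i < n) \sum_(j | j != i) 1.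
  rewrite {2}/S (exchange_big_dep xpredT) //= -big_split /=; apply: eq_bigr => i _.
  have -> : \sum_(j | i != j) conjc (z j t) * (conjc (z j t - z i t))^-1 =
            \sum_(j | j != i) conjc (z j t) * (conjc (z j t - z i t))^-1.
    by apply: eq_bigl => j; rewrite eq_sym.
  rewrite -big_split /=; apply: eq_bigr => j ji.
  have x0 : conjc (z i t) - conjc (z j t) != 0.
    by rewrite -conjcB conjc_eq0 subr_eq0 z_inj // eq_sym.
  have y0 : conjc (z j t) - conjc (z i t) != 0 by rewrite -opprB oppr_eq0.
  by rewrite !conjcB; field; rewrite x0 y0.
have ImS : Im S = 0.
  have : Im (S + S) = 0.
    rewrite SE; rewrite Im_sum big1 // => i _.
    by rewrite Im_sum big1.
  by rewrite Im_add; lra.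
have -> : \sum_(i < n) conjc (z i t) * ('i%C * force mu lambda (z^~ t) i) =
    'i%C * (mu%:C%C * \sum_(i < n) conjc (z i t) * confine (z i t) + lambda%:C%C * S).
  rewrite /S !mulr_sumr -big_split /= mulr_sumr; apply: eq_bigr => i _.
  by rewrite /force -mulr_sumr; ring.
have imc (x : C) : Im (conjc x * confine x) = 0.
  rewrite /confine mulrA [conjc x * x]mulrC mulc_conj.
  rewrite -[1 - _]/((1 : R)%:C%C - (normc x ^+ 2)%:C%C) -rmorphB -fmorphV -rmorphM.
  by [].
rewrite Re_mul /= mul0r mul1r sub0r Im_add !Im_scale ImS mulr0 addr0.
rewrite Im_sum big1 => [|i _]; last exact: imc.
by rewrite mulr0 oppr0 mulr0.
Qed.

End Solution.
End Dynamics.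

(** * From the ring curve to relative choreographies *)

Section Choreography.
Variables (R : realType) (m : nat).
Local Notation C := R[i].
Local Notation normc := (@Normc.normc R).
Local Notation n := m.+2.
Implicit Types (s t : R) (l j : 'I_n).

Lemma vortex_scale (u v : @nonzero R n) (c : C) :
  to_complex (val v) = c *: to_complex (val u) ->
  forall j, vortex (val v) j = c * vortex (val u) j.
Proof. by move=> /rowP e j; have := e j; rewrite !mxE. Qed.

Lemma vortex_scaleP (u v : @nonzero R n) (c : C) : c != 0 ->
  (forall j, vortex (val v) j = c * vortex (val u) j) -> homog u = homog v.
Proof.
move=> c0 e; apply/homogP/asboolP; exists c => //.
by apply/rowP => j; rewrite !mxE; exact: e.
Qed.

(** Both sides scale alike when the plane undergoes a similarity fixing the
    origin, so this is a property of the point of the projective space. *)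
Definition clustered (d : R) (Z : config R n) : Prop :=
  sqnorm (row 0 Z - row 1 Z) <= d * inertia Z.

Lemma clustered_homog (d : R) (u v : @nonzero R n) : homog u = homog v ->
  clustered d (val u) -> clustered d (val v).
Proof.
move=> /homogP/asboolP[c c0 /vortex_scale e]; rewrite /clustered /inertia.
rewrite !sqnorm_rowB !e -mulrBr Normc.normcM exprMn.
have -> : \sum_(i < n) sqnorm (row i (val v)) =
    normc c ^+ 2 * \sum_(i < n) sqnorm (row i (val u)).
  by rewrite mulr_sumr; apply: eq_bigr => i _; rewrite !sqnorm_row e Normc.normcM exprMn.
by move=> h; rewrite [leRHS]mulrCA ler_pM2l // exprn_gt0 // normc_gt0.
Qed.

Definition cp_clustered (d : R) (x : CP R n) : Prop := clustered d (val (repr x)).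

Lemma cp_clusteredE d (u : @nonzero R n) :
  cp_clustered d (homog u) <-> clustered d (val u).
Proof.
have h : homog (repr (homog u)) = homog u by exact: reprK.
by split; apply: clustered_homog.
Qed.

Lemma inertia_ge0 (Z : config R n) : 0 <= inertia Z.
Proof. by rewrite /inertia; apply: sumr_ge0 => i _; rewrite addr_ge0 ?sqr_ge0. Qed.

(** Vortices do not collide, so on each orbit the ratio is positive
    somewhere. *)
Lemma orbit_not_clustered (mu lambda : R) (O : set (CP R n)) :
  choreographic_orbits n mu lambda O ->
  exists2 x, O x & exists2 d : R, 0 < d & ~ cp_clustered d x.
Proof.
move=> [p [Z Zsol [_ _ [_ Zp]]] <-]; have [u uZ up] := Zp 0.
exists (p 0); first by exists 0.
have [[_ noncoll] _] := Zsol 0.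
have s0 : 0 < sqnorm (row 0 (Z 0) - row 1 (Z 0)).
  apply: sqnorm_gt0; rewrite subr_eq0; apply/eqP => e.
  by apply: noncoll; exists 0, 1.
have I0 := inertia_ge0 (Z 0).
exists (sqnorm (row 0 (Z 0) - row 1 (Z 0)) / (inertia (Z 0) + 1)).
  by rewrite divr_gt0 // ltr_wpDl.
rewrite -up cp_clusteredE uZ /clustered; apply/negP; rewrite -ltNge.
by rewrite mulrAC ltr_pdivrMr ?ltr_wpDl // ltr_pM2l // ltrDl.
Qed.

(** Finitely many orbits would share a positive lower bound at which each of
    them escapes [P], contradicting the existence of an orbit inside [P]. *)
Lemma infinite_of_arbitrarily_small (T : Type) (P : R -> T -> Prop) (S : set (set T)) :
  (forall d d1 x, d <= d1 -> P d x -> P d1 x) ->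
  (forall O, S O -> exists2 x, O x & exists2 d : R, 0 < d & ~ P d x) ->
  (forall d : R, 0 < d -> exists2 O, S O & forall x, O x -> P d x) ->
  infinite_set S.
Proof.
move=> mono sep small fS.
have [s Ss] := (@finite_seqP {classic (set T)} S).1 fS.
have [d d0 dP] : exists2 d : R, 0 < d &
    forall O, O \in s -> exists2 x, O x & ~ P d x.
  have : forall O, O \in s -> S O by move=> O; rewrite Ss.
  elim: (s) => [_|O r IH rS]; first by exists 1.
  have [|d d0 dP] := IH; first by move=> O1 h; apply: rS; rewrite inE h orbT.
  have [x Ox [d1 d10 nP]] := sep O (rS O (mem_head _ _)).
  exists (Num.min d d1); first by rewrite lt_min d0 d10.
  move=> O1; rewrite inE => /predU1P[->|/dP[y Oy nPy]].
    by exists x => // /(mono _ d1); rewrite ge_min lexx orbT => /(_ isT).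
  by exists y => // /(mono _ d); rewrite ge_min lexx => /(_ isT).
have [Q SQ QP] := small d d0.
have [|x Qx nP] := dP Q; first by move: SQ; rewrite Ss.
exact: nP (QP x Qx).
Qed.

Variables (mu lambda : R) (r w Om : R) (q q' : R -> C).
Hypotheses (r_gt0 : 0 < r) (w_gt0 : 0 < w).
Hypothesis r_le : r * 8 <= 1.
Hypotheses (q_deriv : cderiv q q') (q_per : turn_periodic q).
Hypothesis q_near : forall s, normc (q s - (1 / 2)%:C%C) <= 2 * r.
Hypothesis q_dist : forall s l, l != 0 -> 0 < normc (q s - q (s - angle l)) <= 4 * r.
Hypothesis q_eqn : forall s, w%:C%C * q' s + 'i%C * (Om%:C%C * q s) =
  'i%C * (mu%:C%C * confine (q s) + lambda%:C%C *
    \sum_(l : 'I_n | l != 0) (conjc (q s - q (s - angle l)))^-1).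

(** The vortices follow the curve in a uniformly turning frame. *)
Let z j t : C := expi (Om * t) * q (w * t - angle j).
Let z' j t : C := expi (Om * t) * (w%:C%C * q' (w * t - angle j)
  + 'i%C * (Om%:C%C * q (w * t - angle j))).

Let normq s : 1 / 4 <= normc (q s) <= 3 / 4.
Proof.
have := q_near s; have := r_le.
have := le_normcD (q s - (1 / 2)%:C%C) (1 / 2)%:C%C.
have := le_normcB (q s) (q s - (1 / 2)%:C%C).
rewrite subrK opprB addrC subrK normc_real ger0_norm; lra.
Qed.

Let q_angle s j l : q (s - angle (j + l)) = q (s - angle j - angle l).
Proof.
have [k ->] := angleD R j l.
rewrite -(turn_periodicz q_per (s - angle j - angle l) (- k)) mulrNz; congr q; ring.
Qed.

Let z_deriv j : cderiv (z j) (z' j).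
Proof.
have d1 := cderiv_affine Om 0 (@cderiv_expi R).
have d2 := cderiv_affine w (- angle j) q_deriv.
apply: cderiv_eq (cderivM d1 d2) _ _ => t; first by rewrite addr0.
by rewrite /z' addr0; ring.
Qed.

Let z_norm j t : normc (z j t) = normc (q (w * t - angle j)).
Proof. by rewrite Normc.normcM normc_expi mul1r. Qed.

Let z_diff i j t : z i t - z j t = expi (Om * t) *
  (q (w * t - angle i) - q (w * t - angle i - angle (j - i))).
Proof.
have ij : i + (j - i) = j by rewrite addrC subrK.
by rewrite /z -q_angle ij mulrBr.
Qed.

Let z_inj i j t : i != j -> z i t != z j t.
Proof.
move=> ij; rewrite -subr_eq0 z_diff mulf_neq0 ?expi_neq0 // -normc_gt0.
have ji : j - i != 0 by rewrite subr_eq0 eq_sym.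
by have /andP[] := q_dist (w * t - angle i) ji.
Qed.

Let z_eqn i t : z' i t = 'i%C * force mu lambda (z^~ t) i.
Proof.
rewrite /z' q_eqn /force.
set s := w * t - angle i; set e := expi (Om * t).
have ee : e * conjc e = 1 by rewrite mulc_conj normc_expi expr1n.
have e0 : e != 0 by exact: expi_neq0.
have -> : confine (z i t) = e * confine (q s).
  rewrite /confine /z -/s -/e conjcM.
  have -> : e * q s * (conjc e * conjc (q s)) = (e * conjc e) * (q s * conjc (q s)) by ring.
  by rewrite ee mul1r mulrA.
have -> : \sum_(j | j != i) (conjc (z i t - z j t))^-1 =
    e * \sum_(l : 'I_n | l != 0) (conjc (q s - q (s - angle l)))^-1.
  rewrite (reindex_inj (addrI i)) mulr_sumr /=.
  apply: eq_big => [l|l _]; first by rewrite -subr_eq0 addrAC subrr add0r.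
  have il : i + l - i = l by rewrite addrAC subrr add0r.
  rewrite z_diff il -/s -/e conjcM invfM; congr (_ * _).
  by apply: (mulIf (_ : conjc e != 0)); rewrite ?conjc_eq0 // mulVf ?conjc_eq0.
by ring.
Qed.

Let Z t : config R n := config_of (z^~ t).

Let Z_sol : is_solution mu lambda Z.
Proof.
apply: (complex_solution z_deriv) => [j t|//|//].
by rewrite z_norm; have := normq (w * t - angle j); lra.
Qed.

Let Z_neq0 t : Z t \in @nonzero R n.
Proof.
apply/mem_set/eqP => Z0; have /eqP : z 0 t != z 1 t by exact: z_inj.
by apply; rewrite -(config_ofK (z^~ t) 0) -(config_ofK (z^~ t) 1) -/(Z t) Z0 /vortex !mxE.
Qed.

Let u t : @nonzero R n := SigSub (Z_neq0 t).
Let p t : CP R n := homog (u t).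

Let p_eq t t1 (c : C) : c != 0 -> (forall j, z j t1 = c * z j t) -> p t = p t1.
Proof.
move=> c0 e; apply: (vortex_scaleP c0) => j.
by rewrite /= !config_ofK.
Qed.

Let p_continuous : continuous p.
Proof.
have cZ : continuous Z.
  move=> t; have [_ [dZ _]] := Z_sol t.
  exact/differentiable_continuous/derivable1_diffP.
have cu : continuous u.
  by apply: (@continuous_comp_initial _ _ _ (set_val : @nonzero R n -> config R n)).
move=> t; apply: (@continuous_comp _ _ _ u (@homog R n)); first exact: cu.
exact: pi_continuous.
Qed.

Let p_choreography : is_reduced_choreography p.
Proof.
split; first exact: p_continuous.
have tp : 0 < pi *+ 2 :> R by rewrite pmulrn_rgt0 // pi_gt0.
exists (pi *+ 2 / w); first by rewrite divr_gt0.
have w0 : w != 0 by rewrite gt_eqF.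
split=> t.
  apply/esym/(@p_eq _ _ (expi (Om * (pi *+ 2 / w)))); first exact: expi_neq0.
  move=> j; rewrite /z mulrDr expiD -[LHS]mulrA [LHS]mulrCA; congr (_ * (_ * _)).
  by rewrite mulrDr [w * (_ / w)]mulrC divfK // addrAC q_per.
rewrite /p sigma1E; apply/esym.
apply: (@vortex_scaleP _ _ (expi (Om * (pi *+ 2 / w / n%:R)))); first exact: expi_neq0.
move=> j; rewrite /= config_ofK.
have -> : vortex (Defs.shift (Z t)) j = z (ord_pred j) t.
  by rewrite -(config_ofK (z^~ t)) /vortex !mxE.
rewrite /z mulrDr expiD -[LHS]mulrA [LHS]mulrCA; congr (_ * (_ * _)).
have -> : ord_pred j = j - 1.
  apply: val_inj => /=; rewrite modnDmr; congr (_ %% _)%N.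
  by rewrite [(1 %% _)%N]modn_small // subn1 addnS.
have [k h] := angleD R (j - 1) 1.
rewrite subrK in h; rewrite h -(turn_periodicz q_per _ k); congr q.
have -> : angle (1 : 'I_n) = pi *+ 2 / n%:R :> R by rewrite /angle /= modn_small // mul1r.
have : n%:R != 0 :> R by rewrite pnatr_eq0.
by move: (n%:R : R) => N N0; field; rewrite w0 N0.
Qed.

Let q_Re_gt0 s : 0 < complex.Re (q s).
Proof.
have := q_near s; have := normc_Re (q s - (1 / 2)%:C%C).
have -> : complex.Re (q s - (1 / 2)%:C%C) = complex.Re (q s) - 1 / 2.
  by case: (q s).
by rewrite ler_norml => /andP[]; move: r_le; lra.
Qed.

(** If the shape were constant, the ratio of two consecutive vortices would be
    an [n]-th root of unity other than [1], so the vortices would sum to [0];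
    but they all lie in a half plane. *)
Let p_nontrivial : is_nontrivial p.
Proof.
move=> [x px].
have q0 s : q s != 0 by rewrite -normc_gt0; have := normq s; lra.
pose K := q (- angle (1 : 'I_n)) / q 0.
have wC : w != 0 by rewrite gt_eqF.
have step s : q (s - angle (1 : 'I_n)) = K * q s.
  have : homog (u 0) = homog (u (s / w)) by rewrite -/(p 0) -/(p (s / w)) !px.
  move=> /homogP/asboolP[c c0 /vortex_scale e].
  have := e 0; have := e 1; rewrite /= !config_ofK /z !mulr0 expi0 !mul1r angle0.
  rewrite [w * (s / w)]mulrC divfK // !subr0 !sub0r => e1 e2.
  apply: (mulfI (expi_neq0 (Om * (s / w)))); rewrite e1 /K mulrCA e2.
  by field.
have iter k s : q (s - k%:R * angle (1 : 'I_n)) = K ^+ k * q s.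
  elim: k => [|k IH]; first by rewrite mul0r subr0 expr0 mul1r.
  by rewrite -natr1 mulrDl mul1r opprD addrA step IH exprS mulrA.
have nangle : n%:R * angle (1 : 'I_n) = pi *+ 2 :> R.
  by rewrite /angle /= modn_small // mul1r mulrC divfK // pnatr_eq0.
have Kn : K ^+ n = 1.
  apply: (mulIf (q0 0)); rewrite mul1r -iter nangle sub0r.
  by rewrite -[LHS]q_per addNr.
have K1 : K != 1.
  apply/eqP => K1; have /andP[+ _] := q_dist 0 (oner_neq0 _ : (1 : 'I_n) != 0).
  by rewrite step K1 mul1r subrr Normc.normc0 ltxx.
have S0 : \sum_(k < n) K ^+ k = 0.
  by apply: (mulfI (_ : K - 1 != 0)); rewrite ?subr_eq0 // -subrX1 Kn subrr mulr0.
have : complex.Re (\sum_(k < n) q (0 - k%:R * angle (1 : 'I_n))) = 0.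
  by under eq_bigr do rewrite iter; rewrite -mulr_suml S0 mul0r.
rewrite Re_sum => /eqP; rewrite psumr_eq0 => [|k _]; last exact: ltW (q_Re_gt0 _).
by move=> /allP/(_ 0 (mem_index_enum _)) /=; rewrite gt_eqF ?q_Re_gt0.
Qed.

(** Two consecutive vortices are at distance at most [4 r], while the cluster
    stays away from the origin. *)
Lemma ring_choreography : exists2 O : set (CP R n), choreographic_orbits n mu lambda O &
  forall d x, r * 16 * 16 <= d -> O x -> cp_clustered d x.
Proof.
exists (range p).
  exists p => //; exists Z; first exact: Z_sol.
  split; [exact: p_choreography|exact: p_nontrivial|split].
    exists (inertia (Z 0)) => [|t]; last exact: (inertia_constant z_deriv z_inj z_eqn).
    rewrite /inertia (bigD1 0) //= ltr_pwDl //.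
      rewrite sqnorm_row config_ofK z_norm exprn_gt0 //.
      by have := normq (w * 0 - angle (0 : 'I_n)); lra.
    by apply: sumr_ge0 => i _; rewrite addr_ge0 ?sqr_ge0.
  by move=> t; exists (u t).
move=> d _ rd [t _ <-]; apply/cp_clusteredE; rewrite /clustered /=.
rewrite sqnorm_rowB !config_ofK z_diff Normc.normcM normc_expi mul1r subr0 angle0 subr0.
have /andP[_ h] := q_dist (w * t) (oner_neq0 _ : (1 : 'I_n) != 0).
have I0 : 1 / 16 <= inertia (Z t).
  rewrite /inertia (bigD1 0) //= sqnorm_row config_ofK z_norm.
  have /andP[h1 _] := normq (w * t - angle (0 : 'I_n)).
  have h2 : 0 <= \sum_(i < n | i != 0) sqnorm (row i (Z t)).
    by apply: sumr_ge0 => i _; rewrite addr_ge0 ?sqr_ge0.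
  nra.
have h3 : normc (q (w * t) - q (w * t - angle (1 : 'I_n))) ^+ 2 <= 16 * r ^+ 2.
  have := normc_ge0 (q (w * t) - q (w * t - angle (1 : 'I_n))); nra.
have r1 : 16 * r ^+ 2 <= r * 16 by move: r_le r_gt0; nra.
have d0 : 0 < d by move: r_gt0; lra.
have := ler_wpM2l (ltW d0) I0; lra.
Qed.

End Choreography.

Theorem theorem3p2 (R : realType) (mu lambda : R) (hmu : 0 < mu)
    (hlambda : 0 < lambda) (n : nat) (hn : (1 < n)%N) :
  infinite_set (choreographic_orbits n mu lambda).
Proof.
case: n hn => [|[|m]] // _.
have [r0 r0_gt0 curve] := @ring_curve_exists R m mu lambda hmu hlambda.
apply: (@infinite_of_arbitrarily_small R _ (@cp_clustered R m)) => [d d1 x d_le|O|d d_gt0].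
- rewrite /cp_clustered /clustered => /le_trans; apply.
  by rewrite ler_wpM2r ?inertia_ge0.
- exact: orbit_not_clustered.
pose r := Num.min r0 (Num.min (1 / 8) (d / 16 / 16)).
have r_gt0 : 0 < r by rewrite !lt_min r0_gt0 !divr_gt0.
have r_le : r <= r0 by rewrite ge_min lexx.
have r8 : r * 8 <= 1 by rewrite -ler_pdivlMr // !ge_min lexx orbT.
have rd : r * 16 * 16 <= d by rewrite -!ler_pdivlMr // !ge_min lexx !orbT.
have [q [q' [w [Om [[dq pq] w_gt0 near dist eqn]]]]] := curve r r_gt0 r_le.
have [Q SQ QP] := ring_choreography r_gt0 w_gt0 r8 dq pq near dist eqn.
by exists Q => // x; exact: QP.
Qed.
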